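(* Let $Q:\mathbb{R}\to\mathbb{R}$ satisfy: (i) $Q\in C^4(\mathbb{R})$; (ii) $Q$ is convex on $\mathbb{R}$; (iii) $\liminf_{x\to\pm\infty}Q(x)>\inf_{\mathbb{R}}Q$ (at both $+\infty$ and $-\infty$); (iv) $\min_{\mathbb{R}}Q=Q(0)=0$; (v) $\alpha\ge-P^{-1}(-P(\alpha))$ for all $\alpha>q_2$, where $[q_1,q_2]:=\{x\in\mathbb{R}:Q(x)=0\}$. Then there exists a constant $C>0$ such that $$\|\overline\rho\|_\infty\le C\big(\|Q_\alpha''\|_{L^\infty(\operatorname{supp}\overline\rho)}+1\big)\qquad\text{for all }\alpha>\max\{q_2,1\}.$$
   Context: The interaction potential is $K(x):=-\log|\tanh x|$, and $P(x):=\int_0^xQ(y)\,dy$. The set $[q_1,q_2]$ of minimizers of $Q$ is a compact interval containing $0$ (possibly $\{0\}$), and $P^{-1}:\mathbb{R}\setminus\{0\}\to\mathbb{R}$ denotes the inverse of $P|_{\mathbb{R}\setminus[q_1,q_2]}$. For $\alpha>q_2$ set $$K_\alpha(x):=\alpha K(\alpha x),\qquad Q_\alpha(x):=\frac{\alpha}{P(\alpha)}Q(\alpha x),$$ and, for $\rho$ in the space $\mathcal P(\mathbb{R})$ of probability measures on $\mathbb{R}$, $$E^\alpha(\rho):=\frac12\int_{\mathbb{R}}\int_{\mathbb{R}}K_\alpha(x-y)\,d\rho(y)\,d\rho(x)+\int_{\mathbb{R}}Q_\alpha(x)\,d\rho(x)\in\mathbb{R}\cup\{\infty\}.$$ $\overline\rho$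 (depending on $\alpha$) is the unique minimizer of $E^\alpha$ over $\mathcal P(\mathbb{R})$. It is known that $\overline\rho$ is absolutely continuous with a Hölder continuous density on $\mathbb{R}$, also denoted $\overline\rho$, and that its support is a compact interval. *)

(* Defs.v *)
From HB Require Import structures.
From mathcomp Require Import all_boot all_order all_algebra.
From mathcomp Require Import all_classical all_reals all_analysis.
Set Implicit Arguments.
Unset Strict Implicit.
Unset Printing Implicit Defensive.
Import Order.TTheory GRing.Theory Num.Theory.
Import numFieldNormedType.Exports.

Local Open Scope classical_set_scope.
Local Open Scope ring_scope.

Definition tanh {R : realType} (x : R) : R :=
  (expR x - expR (- x)) / (expR x + expR (- x)).

(* [ln 0 = 0] in the library, so the value +oo of [- log |tanh x|] at [x = 0]
   is given explicitly; it makes every measure with an atom have infinite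
   energy. *)
Definition Kpot {R : realType} (x : R) : \bar R :=
  if x == 0 then +oo%E else (- ln `|tanh x|)%:E.

Definition Kscaled {R : realType} (alpha x : R) : \bar R :=
  (alpha%:E * Kpot (alpha * x))%E.

(* The library integral is not oriented, hence the case distinction on the
   sign of [x]. *)
Definition primitive0 {R : realType} (Q : R -> R) (x : R) : R :=
  if 0 <= x then Rintegral (@lebesgue_measure R) `[0, x] Q
  else - Rintegral (@lebesgue_measure R) `[x, 0] Q.

Definition primitive0_inv {R : realType} (Q : R -> R) (q1 q2 : R) : R -> R :=
  pinv (~` `[q1, q2]) (primitive0 Q).

Definition Qscaled {R : realType} (Q : R -> R) (alpha x : R) : R :=
  alpha / primitive0 Q alpha * Q (alpha * x).

Definition energy {R : realType} (Q : R -> R) (alpha : R)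
    (rho : probability (measurableTypeR R) R) : \bar R :=
  ((2^-1)%:E * (\int[rho]_x \int[rho]_y Kscaled alpha (x - y))
   + \int[rho]_x (Qscaled Q alpha x)%:E)%E.

(* Two probability measures are identified when they agree on measurable sets:
   the value of a library measure on other sets is irrelevant. *)
Definition is_unique_minimizer {R : realType} (Q : R -> R) (alpha : R)
    (rho : probability (measurableTypeR R) R) : Prop :=
  (forall nu : probability (measurableTypeR R) R,
     (energy Q alpha rho <= energy Q alpha nu)%E) /\
  (forall nu : probability (measurableTypeR R) R,
     energy Q alpha nu = energy Q alpha rho ->
     forall A : set (measurableTypeR R), measurable A -> nu A = rho A).

Definition has_density {R : realType}
    (rho : probability (measurableTypeR R) R) (f : R -> R) : Prop :=
  (forall x, 0 <= f x) /\
  (forall A : set (measurableTypeR R), measurable A ->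
     rho A = (\int[@lebesgue_measure R]_(x in A) (f x)%:E)%E).

Definition hoelder_continuous {R : realType} (f : R -> R) : Prop :=
  exists s L : R, [/\ 0 < s, s <= 1 &
    forall x y : R, `|f x - f y| <= L * `|x - y| `^ s].

Definition msupp {R : realType} (rho : probability (measurableTypeR R) R) :
    set R :=
  [set x | forall U : set R, open U -> U x -> (0 < rho U)%E].

Definition Ck {R : realType} (k : nat) (f : R -> R) : Prop :=
  (forall (i : nat) (x : R), (i < k)%N -> derivable (derive1n i f) x 1) /\
  continuous (derive1n k f).

(* L^oo(D) norm with respect to Lebesgue measure: extending by 0 outside [D]
   does not change it. *)
Definition Linfty_norm {R : realType} (D : set R) (f : R -> R) : \bar R :=
  ('N[@lebesgue_measure R]_+oo[EFin \o (f \_ D)])%E.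

(* Main.v *)
(* Let k be the rescaled kernel, c its integral and f the density, so that
   k * f + Q = lambda where f > 0 and k * f + Q >= lambda elsewhere. Testing
   with the uniform density on [0, 1] gives lambda <= c + 1, because the
   normalisation of Q makes its integral over [0, 1] equal to 1. At a maximum
   point x of f, c f(x) = (k * f)(x) + int k(z) (f(x) - f(x - z)) dz. The last
   integral is controlled by Q'' through the pointwise inequality
   k(z + t) + k(z - t) >= (2 + alpha^2 t^2) k(z) for |z| > t, a finite-difference
   form of k'' >= alpha^2 k: the second difference of the Euler-Lagrange
   equation at x yields alpha^2 int k(z) (f(x) - f(x - z)) dz <= 2 sup Q''.
   Since f is only Hoelder continuous, the singularity of k at 0 is not
   compensated by f(x) - f(x - z); the argument is therefore run with the
   averages of f over intervals of length 2 e, which are C^1 with Hoelder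
   continuous derivative, and e -> 0 at the end. *)

Require Import Defs.
From HB Require Import structures.
From mathcomp Require Import all_boot all_order all_algebra.
From mathcomp Require Import all_classical all_reals all_analysis.
From mathcomp Require Import measurable_realfun ess_sup_inf.
From mathcomp Require Import ring lra.
Import Order.TTheory GRing.Theory Num.Theory.
Import numFieldNormedType.Exports.

Set Implicit Arguments.
Unset Strict Implicit.
Unset Printing Implicit Defensive.

Local Open Scope classical_set_scope.
Local Open Scope ring_scope.

(** * Calculus *)

Lemma ge0_of_affine {R : realFieldType} (X Y d : R) : 0 < d ->
  (forall e, 0 < e -> e <= d -> 0 <= X + e * Y) -> 0 <= X.
Proof.
move=> d0 main; rewrite leNgt; apply/negP => X0.
have nY : 0 < 2 * (`|Y| + 1) by rewrite mulr_gt0// ltr_wpDl.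
pose e := Num.min d (- X / (2 * (`|Y| + 1))).
have e0 : 0 < e by rewrite lt_min d0 divr_gt0 ?oppr_gt0.
have ed : e <= d by rewrite ge_min lexx.
have : e <= - X / (2 * (`|Y| + 1)) by rewrite ge_min lexx orbT.
rewrite ler_pdivlMr// => eX; have := main e e0 ed.
have : e * Y <= e * `|Y| by rewrite ler_wpM2l ?ler_norm// ltW.
by move: eX; rewrite mulrCA; lra.
Qed.

Lemma fin_num_ge0 {R : realDomainType} (x : \bar R) : (0 <= x)%E -> (x < +oo)%E -> x \is a fin_num.
Proof. by move=> x0; rewrite ge0_fin_numE. Qed.

Lemma powRVK {R : realType} (p x : R) : 0 < p -> 0 <= x -> (x `^ p^-1) `^ p = x.
Proof. by move=> p0 x0; rewrite -powRrM mulVf ?gt_eqF// powRr1. Qed.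

Lemma powRKV {R : realType} (p x : R) : 0 < p -> 0 <= x -> (x `^ p) `^ p^-1 = x.
Proof. by move=> p0 x0; rewrite -powRrM mulfV ?gt_eqF// powRr1. Qed.

Section calculus.
Context {R : realType}.
Local Notation mu := (@lebesgue_measure R).

Lemma mean_value (g dg : R -> R) (a b : R) : a <= b ->
  (forall x, a <= x <= b -> is_derive x 1 g (dg x)) ->
  exists2 c, a <= c <= b & g b - g a = dg c * (b - a).
Proof.
move=> ab gd; have [] := @MVT_segment R g dg a b ab.
- by move=> x; rewrite in_itv/= => /andP[ax xb]; apply: gd; rewrite !ltW.
- apply: derivable_within_continuous => x; rewrite in_itv/= => /gd h.
  exact: (@ex_derive _ _ _ _ _ _ _ h).
- by move=> c; rewrite in_itv/= => ? ?; exists c.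
Qed.

Lemma mean_value_sub (g dg : R -> R) (x z : R) :
  (forall y : R, is_derive y 1 g (dg y)) ->
  exists2 c, `|c - x| <= `|z| & g x - g (x - z) = dg c * z.
Proof.
move=> dgP; have [z0|z0] := leP 0 z.
  have xz : x - z <= x by lra.
  have [c /andP[c1 c2] E] := mean_value xz (fun y _ => dgP y).
  exists c; last by rewrite E; congr (_ * _); lra.
  by rewrite ler_norml ger0_norm//; apply/andP; split; lra.
have xz : x <= x - z by lra.
have [c /andP[c1 c2] E] := mean_value xz (fun y _ => dgP y).
exists c; last by rewrite -opprB E; lra.
by rewrite ler_norml ltr0_norm//; apply/andP; split; lra.
Qed.

Lemma is_derive_continuous (g dg : R -> R) :
  (forall y : R, is_derive y 1 g (dg y)) -> continuous g.
Proof.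
move=> dgP x; apply/differentiable_continuous/derivable1_diffP.
exact: (@ex_derive _ _ _ _ _ _ _ (dgP x)).
Qed.

Lemma is_derive_shift (g dg : R -> R) (c x : R) :
  (forall y : R, is_derive y 1 g (dg y)) -> is_derive x 1 (fun y => g (y + c)) (dg (x + c)).
Proof.
move=> dgP; have H := dgP (x + c).
have dc : is_derive x 1 (fun y : R => y + c) 1 by apply: is_derive_eq; rewrite addr0.
have := @is_derive1_comp R g (fun y => y + c) x _ _ H dc.
by rewrite mulr1.
Qed.

Lemma second_difference_le_sup (g g1 g2 : R -> R) (q y t : R) :
  (forall x : R, is_derive x 1 g (g1 x)) -> (forall x : R, is_derive x 1 g1 (g2 x)) ->
  0 <= t -> 0 <= q -> (forall x, `|x - y| <= t -> g2 x <= q) ->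
  g (y + t) + g (y - t) <= 2 * g y + 2 * (q * t ^+ 2).
Proof.
move=> dg dg1 t0 q0 g2q.
pose chi s := g (y + s) + g (y - s).
have dchi (s : R) : is_derive s 1 chi (g1 (y + s) - g1 (y - s)).
  have h1 := is_derive_shift y s dg.
  have h2 : is_derive s 1 (fun s => g (y - s)) (- g1 (y - s)).
    have dc : is_derive s 1 (fun s : R => y - s) (- 1).
      by apply: is_derive_eq; rewrite add0r mul1r.
    have := @is_derive1_comp R g (fun s => y - s) s _ _ (dg (y - s)) dc.
    by rewrite mulrN1.
  have -> : chi = (fun w => g (w + y)) + (fun w => g (y - w)).
    by apply/funext => w; rewrite /chi (addrC y w).
  by rewrite (addrC y s); exact: is_deriveD.
have [c /andP[c0 ct] E] := mean_value t0 (fun s _ => dchi s).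
have yc : y - c <= y + c by lra.
have [w /andP[w1 w2] E1] := mean_value yc (fun z _ => dg1 z).
have wq : g2 w <= q by apply: g2q; rewrite ler_norml; apply/andP; split; lra.
have E2 : chi t = chi 0 + (g2 w * (c + c)) * t by move: E; rewrite E1; lra.
rewrite -/(chi t) E2 /chi addr0 subr0.
have : g2 w * (c + c) <= q * (t + t).
  have [w0|/ltW w0] := leP 0 (g2 w); first by apply: ler_pM => //; lra.
  by apply: (@le_trans _ _ 0); [rewrite mulr_le0_ge0//; lra|rewrite mulr_ge0//; lra].
by nra.
Qed.

Lemma integral_is_derive (g G : R -> R) (u v : R) : u < v -> {within `[u, v], continuous g} ->
  (forall x : R, u <= x <= v -> is_derive x 1 G (g x)) ->
  (\int[mu]_(x in `[u, v]) (g x)%:E = (G v - G u)%:E)%E.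
Proof.
move=> uv cg dG; rewrite (@continuous_FTC2 _ g G)//.
- have cG x : u <= x <= v -> {for x, continuous G}.
    move=> xuv; apply/differentiable_continuous/derivable1_diffP.
    exact: (@ex_derive _ _ _ _ _ _ _ (dG x xuv)).
  split.
  + move=> z; rewrite in_itv/= => /andP[uz zv].
    by apply: (@ex_derive _ _ _ _ _ _ _ (dG z _)); rewrite !ltW.
  + by apply: cvg_at_right_filter; apply: cG; rewrite lexx ltW.
  + by apply: cvg_at_left_filter; apply: cG; rewrite lexx ltW.
- move=> z; rewrite in_itv/= => /andP[uz zv]; rewrite derive1E.
  by apply: (@derive_val _ _ _ _ _ _ _ (dG z _)); rewrite !ltW.
Qed.

Lemma hoelder_coef_ge0 (f : R -> R) (s L : R) :
  (forall x y, `|f x - f y| <= L * `|x - y| `^ s) -> 0 <= L.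
Proof.
by move=> fL; have := le_trans (normr_ge0 _) (fL 1 0); rewrite subr0 normr1 powR1 mulr1.
Qed.

Lemma hoelder_is_continuous (f : R -> R) (s L : R) : 0 < s ->
  (forall x y, `|f x - f y| <= L * `|x - y| `^ s) -> continuous f.
Proof.
move=> s0 fL; have L0 := hoelder_coef_ge0 fL.
move=> x; apply/cvgrPdist_lt => /= e e0.
have e1 : 0 < e / (L + 1) by rewrite divr_gt0// ltr_wpDl.
near=> y; apply: le_lt_trans (fL x y) _.
have xy : `|x - y| <= (e / (L + 1)) `^ s^-1.
  near: y; apply: cvgr_dist_le; first exact: cvg_id.
  exact: powR_gt0.
have : `|x - y| `^ s <= e / (L + 1).
  rewrite -[leRHS](powRVK s0 (ltW e1)).
  by apply: ge0_ler_powR => //; rewrite ?nnegrE ?powR_ge0 ?(ltW s0).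
move=> h; apply: (@le_lt_trans _ _ (L * (e / (L + 1)))); first by rewrite ler_wpM2l.
by rewrite mulrA ltr_pdivrMr ?ltr_wpDl// mulrDr mulr1 mulrC ltrDl.
Unshelve. all: by end_near. Qed.

Lemma continuous_primitive (g : R -> R) (u : R) : continuous g ->
  exists G : R -> R, forall x, u < x -> is_derive x 1 G (g x).
Proof.
move=> cg; exists (fun x => Rintegral mu `[u, x] g) => x ux.
have x1 : x < x + 1 by lra.
have ix : mu.-integrable `[u, x + 1] (EFin \o g).
  apply: continuous_compact_integrable; first exact: segment_compact.
  exact: continuous_subspaceT.
have [d1 d2] := continuous_FTC1_closed x1 ix ux (cg x).
by apply: DeriveDef; [exact: d1|rewrite -derive1E].
Qed.

Lemma integral_scale_arg (g : R -> R) (c : R) : continuous g -> 0 < c ->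
  (\int[mu]_(x in `[0%R, 1%R]) (c * g (c * x))%:E = \int[mu]_(x in `[0%R, c]) (g x)%:E)%E.
Proof.
move=> cg c0; have [G dG] := continuous_primitive (-1) cg.
have dGc (x : R) : 0 <= x -> is_derive x 1 (fun y => G (c * y)) (c * g (c * x)).
  move=> x0; have Gx : is_derive (c * x) 1 G (g (c * x)).
    by apply: dG; rewrite (@lt_le_trans _ _ 0)// mulr_ge0// ltW.
  have cx : is_derive x 1 (fun y : R => c * y) c.
    by apply: is_derive_eq; rewrite /GRing.scale/= mulr1.
  have := @is_derive1_comp R G (fun y => c * y) x _ _ Gx cx.
  by rewrite mulrC.
have cgc : continuous (fun x => c * g (c * x)).
  move=> x; have cx : c * y @[y --> x] --> c * x by apply: cvgM; [exact: cvg_cst|exact: cvg_id].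
  by apply: cvgM; [exact: cvg_cst|exact: cvg_comp cx (cg (c * x))].
have dGc01 (x : R) : 0 <= x <= 1 -> is_derive x 1 (fun y => G (c * y)) (c * g (c * x)).
  by move=> /andP[x0 _]; exact: dGc.
have dG0c (x : R) : 0 <= x <= c -> is_derive x 1 G (g x).
  by move=> /andP[x0 _]; apply: dG; lra.
rewrite (integral_is_derive ltr01 (continuous_subspaceT cgc) dGc01).
by rewrite (integral_is_derive c0 (continuous_subspaceT cg) dG0c) mulr1 mulr0.
Qed.

Lemma ge0_integral_oy_le (m M : R -> R) (B : R) :
  (forall x : R, 0 < x -> is_derive x 1 M (m x)) -> (forall x, 0 < x -> 0 <= m x) ->
  {in `]0, +oo[, continuous m} -> (forall x, 0 < x -> 0 <= M x <= B) ->
  (\int[mu]_(x in `]0%R, +oo[) (m x)%:E <= B%:E)%E.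
Proof.
move=> dM m0 cm MB.
pose F (n : nat) : set R := `[n.+1%:R^-1, n.+1%:R]%classic.
have FU : `]0, +oo[%classic = \bigcup_n F n.
  apply/seteqP; split=> x /=; rewrite /F/= in_itv/= ?andbT; last first.
    move=> [n _]; rewrite /= !in_itv/= => /andP[nx _].
    by rewrite (lt_le_trans _ nx)// invr_gt0.
  move=> x0; have [n nx] : exists n : nat, Num.max x x^-1 <= n.+1%:R.
    exists (Num.truncn (Num.max x x^-1)).
    by rewrite ltW// truncnS_gt.
  move: nx; rewrite ge_max => /andP[xn nx]; exists n => //=.
  by rewrite in_itv/= xn andbT -[x]invrK lef_pV2 ?posrE ?invr_gt0.
have F0 n x : F n x -> 0 < x.
  by rewrite /F/= in_itv/= => /andP[+ _]; apply: lt_le_trans; rewrite invr_gt0.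
have := @ge0_nondecreasing_set_cvg_integral _ (measurableTypeR R) R F (EFin \o m) mu.
rewrite -FU => cvgF.
have cF : (\int[mu]_(x in F i) (m x)%:E)%E @[i --> \oo] --> (\int[mu]_(x in `]0%R, +oo[) (m x)%:E)%E.
  apply: cvgF.
  - move=> i j ij; apply/subsetPset => x; rewrite /F/= !in_itv/= => /andP[ix xi]; apply/andP; split.
      by apply: le_trans ix; rewrite lef_pV2 ?posrE// ler_nat.
    by apply: le_trans xi _; rewrite ler_nat.
  - by move=> i; exact: measurable_itv.
  - move=> i; apply/measurable_EFinP.
    have mm : measurable_fun (`]0, +oo[%classic : set R) m.
      by apply: open_continuous_measurable_fun => // x; rewrite inE; exact: cm.
    by apply: measurable_funS mm => // x /F0 x0; rewrite /= in_itv/= x0.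
  - by move=> i x /F0 x0; rewrite lee_fin m0.
rewrite -(cvg_lim _ cF)//; apply: lime_le; first by apply/cvg_ex; eexists; exact: cF.
apply: nearW => n.
have [-> |n0] := eqVneq n 0%N.
  rewrite /F invr1 set_itv1 integral_set1 lee_fin; have /andP[] := MB 1 ltr01; exact: le_trans.
have nn : n.+1%:R^-1 < n.+1%:R :> R.
  by rewrite (@lt_trans _ _ 1)// ?invf_lt1// ?ltr1n ltnS lt0n.
have cmn : {within `[n.+1%:R^-1, n.+1%:R], continuous m}.
  apply: continuous_in_subspaceT => x; rewrite inE => /F0 x0.
  by apply: cm; rewrite in_itv/= x0.
have dMn (x : R) : n.+1%:R^-1 <= x <= n.+1%:R -> is_derive x 1 M (m x).
  by move=> /andP[nx _]; apply: dM; rewrite (lt_le_trans _ nx)// invr_gt0.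
rewrite (integral_is_derive nn cmn dMn) lee_fin.
have /andP[_ h1] := MB n.+1%:R (ltr0Sn _ _).
have /andP[h2 _] : 0 <= M n.+1%:R^-1 <= B by apply: MB; rewrite invr_gt0.
by lra.
Qed.

End calculus.

(** * The kernel *)

Section kernel.
Context {R : realType}.
Implicit Types x y z t : R.

Lemma tanhN x : tanh (- x) = - tanh x.
Proof. by rewrite /tanh opprK -mulNr opprB (addrC (expR (- x)) (expR x)). Qed.

Lemma tanh0 : tanh (0 : R) = 0.
Proof. by rewrite /tanh oppr0 subrr mul0r. Qed.

Lemma tanhE x : tanh x = 1 - 2 / (expR (2 * x) + 1).
Proof.
rewrite /tanh mulrC expRN expRM_natl expr2 -expRN expRN.
have e0 := expR_gt0 x; have e2 : 0 < expR x * expR x + 1 by rewrite addr_gt0 ?mulr_gt0.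
by field; rewrite !gt_eqF// addr_gt0 ?invr_gt0.
Qed.

Lemma tanh_lt1 x : tanh x < 1.
Proof. by rewrite tanhE gtrBl divr_gt0// addr_gt0 ?expR_gt0. Qed.

Lemma tanh_gt0 x : 0 < x -> 0 < tanh x.
Proof.
move=> x0; apply: divr_gt0; last by rewrite addr_gt0 ?expR_gt0.
by rewrite subr_gt0 ltr_expR gtrN.
Qed.

Lemma le_tanh : {homo @tanh R : x y / x <= y}.
Proof.
move=> x y xy; rewrite !tanhE lerD2l lerN2 ler_pM2l// lef_pV2 ?posrE ?addr_gt0 ?expR_gt0//.
by rewrite lerD2r ler_expR ler_pM2l.
Qed.

Lemma tanh_ge0 x : 0 <= x -> 0 <= tanh x.
Proof. by rewrite -{2}tanh0; exact: le_tanh. Qed.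

Lemma norm_tanh x : `|tanh x| = tanh `|x|.
Proof.
have [x0|x0] := leP 0 x; first by rewrite !ger0_norm ?tanh_ge0.
have Nx0 : 0 <= - x by rewrite oppr_ge0 ltW.
by rewrite -normrN -tanhN (ger0_norm (tanh_ge0 Nx0)) ?ltr0_norm.
Qed.

(* Since [ln 0 = 0], [lncoth 0 = 0] and not [+oo]; this changes the potential on
   a null set only, which densities do not see. *)
Definition lncoth x : R := - ln `|tanh x|.

Lemma lncothN x : lncoth (- x) = lncoth x.
Proof. by rewrite /lncoth tanhN normrN. Qed.

Lemma lncoth_norm x : lncoth `|x| = lncoth x.
Proof. by rewrite /lncoth norm_tanh normr_id -norm_tanh. Qed.

Lemma lncothE x : 0 < x -> lncoth x = - ln (tanh x).
Proof. by move=> x0; rewrite /lncoth norm_tanh ger0_norm// ltW. Qed.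

Lemma lncoth_ge0 x : 0 <= lncoth x.
Proof. by rewrite oppr_ge0 ln_le0// norm_tanh ltW// tanh_lt1. Qed.

Lemma lncoth_gt0 x : 0 < x -> 0 < lncoth x.
Proof. by move=> x0; rewrite lncothE// oppr_gt0 ln_lt0// tanh_gt0// tanh_lt1. Qed.

Lemma lncoth_le x y : 0 < x -> x <= y -> lncoth y <= lncoth x.
Proof.
move=> x0 xy; have y0 := lt_le_trans x0 xy.
by rewrite !lncothE// lerN2 ler_ln ?posrE ?tanh_gt0// le_tanh.
Qed.

Lemma is_derive_tanh x : is_derive x 1 (@tanh R) (1 - tanh x ^+ 2).
Proof.
have p0 : expR x + expR (- x) != 0 by rewrite gt_eqF// addr_gt0 ?expR_gt0.
rewrite /tanh; apply: is_derive_eq.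
rewrite /GRing.scale/=; field.
exact: p0.
Qed.

Lemma continuous_tanh : continuous (@tanh R).
Proof.
move=> x; apply/differentiable_continuous/derivable1_diffP.
exact: (@ex_derive _ _ _ _ _ _ _ (is_derive_tanh x)).
Qed.

Lemma measurable_lncoth : measurable_fun setT lncoth.
Proof.
apply: measurableT_comp => //; apply: measurableT_comp; first exact: measurable_ln.
by apply: measurableT_comp => //; apply: continuous_measurable_fun; exact: continuous_tanh.
Qed.

Lemma ln_artanh_le v t : 0 <= v -> 1 <= t -> t * v < 1 ->
  t * ln ((1 + v) / (1 - v)) <= ln ((1 + t * v) / (1 - t * v)).
Proof.
move=> v0 t1 tv1; have t0 : 0 < t by exact: lt_le_trans t1.
pose g x := (ln (1 + t * x) - ln (1 - t * x)) - t * (ln (1 + x) - ln (1 - x)).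
have B x : 0 <= x <= v -> [/\ 0 <= x, 0 < 1 + t * x, 0 < 1 - t * x, 0 < 1 + x & 0 < 1 - x].
  move=> /andP[x0 xv]; have txv : t * x <= t * v by rewrite ler_pM2l.
  have xtx : x <= t * x by rewrite ler_peMl.
  by split; lra || (have := mulr_ge0 (ltW t0) x0; lra).
have dg x : 0 <= x <= v -> is_derive x 1 g
    ((t / (1 + t * x) + t / (1 - t * x)) - t * ((1 + x)^-1 + (1 - x)^-1)).
  move=> /B[x0 a1 a2 a3 a4].
  have := is_derive1_ln a1; have := is_derive1_ln a2.
  have := is_derive1_ln a3; have := is_derive1_ln a4 => *.
  rewrite /g; apply: is_derive_eq; rewrite /GRing.scale/=.
  by field; rewrite !gt_eqF.
have [x xv] := mean_value v0 dg; have [x0 a1 a2 a3 a4] := B _ xv.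
have -> : g 0 = 0 by rewrite /g !mulr0 !addr0 !subr0 ln1 !subrr mulr0 subrr.
rewrite !subr0 => e.
have {e} : 0 <= g v.
  rewrite e mulr_ge0//.
  have -> : t / (1 + t * x) + t / (1 - t * x) - t * ((1 + x)^-1 + (1 - x)^-1)
    = t * (2 * x ^+ 2 * (t ^+ 2 - 1)) / ((1 + t * x) * (1 - t * x) * ((1 + x) * (1 - x))).
    by field; rewrite !gt_eqF.
  have t21 : 0 <= t ^+ 2 - 1 by rewrite subr_ge0 exprn_ege1.
  by rewrite divr_ge0 ?mulr_ge0 ?sqr_ge0 ?t21 ?(ltW t0) ?(ltW a1) ?(ltW a2) ?(ltW a3) ?(ltW a4).
have [_ a1' a2' a3' a4'] : [/\ 0 <= v, 0 < 1 + t * v, 0 < 1 - t * v, 0 < 1 + v & 0 < 1 - v].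
  by apply: B; rewrite v0 lexx.
by rewrite !ln_div ?posrE// /g subr_ge0.
Qed.

(* With c = cosh 2z and s = cosh 2t one has
   tanh (z + t) tanh (z - t) = (c - s) / (c + s) and tanh z ^ 2 = (c - 1) / (c + 1),
   so the claim is [artanh (s / c) >= s * artanh (1 / c)]. *)
Lemma lncoth_shift_gt0 z t : 0 < t -> t < z ->
  2 * ((expR (2 * t) + expR (- (2 * t))) / 2) * lncoth z <= lncoth (z + t) + lncoth (z - t).
Proof.
move=> t0 tz; set s := (_ + _) / 2.
have z0 : 0 < z by exact: lt_trans tz.
pose c := (expR (2 * z) + expR (- (2 * z))) / 2.
have [ez et] : 0 < expR z /\ 0 < expR t by rewrite !expR_gt0.
have ez1 : 1 < expR z by rewrite expR_gt1.
have et1 : 1 < expR t by rewrite expR_gt1.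
have etz : expR t < expR z by rewrite ltr_expR.
have cE : c = (expR z ^+ 2 + expR z ^- 2) / 2 by rewrite /c expRN expRM_natl.
have sE : s = (expR t ^+ 2 + expR t ^- 2) / 2 by rewrite /s expRN expRM_natl.
have X1 : 1 < expR z * expR z by rewrite mulr_egt1.
have sc : s < c.
  rewrite sE cE ltr_pM2r// -subr_gt0.
  have -> : expR z ^+ 2 + expR z ^- 2 - (expR t ^+ 2 + expR t ^- 2) =
    (expR z ^+ 2 - expR t ^+ 2) * (1 - (expR z * expR t) ^- 2).
    by field; rewrite !gt_eqF.
  apply: mulr_gt0; first by rewrite subr_gt0 ltrXn2r// ?nnegrE ltW.
  rewrite subr_gt0 invf_lt1 ?exprn_gt0 ?mulr_gt0// exprn_egt1// mulr_egt1//.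
have s1 : 1 <= s.
  rewrite sE -subr_ge0; have -> : (expR t ^+ 2 + expR t ^- 2) / 2 - 1 =
    (expR t - (expR t)^-1) ^+ 2 / 2 by field; rewrite gt_eqF.
  by rewrite divr_ge0 ?sqr_ge0.
have c0 : 0 < c by lra.
have lE : lncoth z *+ 2 = ln ((1 + c^-1) / (1 - c^-1)).
  rewrite lncothE// mulNrn -lnXn ?tanh_gt0// -lnV ?posrE ?exprn_gt0 ?tanh_gt0//.
  congr ln; rewrite /tanh expRN cE.
  field; apply/and5P; split; rewrite gt_eqF//.
  - rewrite (_ : _ - _ = (expR z * expR z - 1) ^+ 2); last by ring.
    by rewrite exprn_gt0// subr_gt0.
  - by rewrite subr_gt0.
have rE : lncoth (z + t) + lncoth (z - t) = ln ((1 + s * c^-1) / (1 - s * c^-1)).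
  have [zt0 zmt0] : 0 < z + t /\ 0 < z - t by rewrite subr_gt0 addr_gt0.
  have [h1 h2] := (tanh_gt0 zt0, tanh_gt0 zmt0).
  rewrite !lncothE// -opprD -lnM ?posrE// -lnV ?posrE ?(mulr_gt0 h1 h2)//.
  congr ln; rewrite /tanh !expRN !expRD expRN cE sE.
  have D : expR z * expR z - expR t * expR t > 0 by rewrite subr_gt0 ltr_pM// ltW.
  have D' : expR z * expR t * (expR z * expR t) - 1 > 0.
    by rewrite subr_gt0 mulr_egt1// mulr_egt1.
  field; do !(apply/andP; split); rewrite gt_eqF//.
  - rewrite (_ : _ - _ = (expR z * expR z - expR t * expR t) *
      (expR z * expR t * (expR z * expR t) - 1)); last by ring.
    by rewrite mulr_gt0.
  - by rewrite addr_gt0 ?mulr_gt0.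
  - by rewrite mulNr.
have -> : 2 * s * lncoth z = s * (lncoth z *+ 2) by rewrite -[lncoth z *+ 2]mulr_natl; ring.
rewrite rE lE.
by apply: ln_artanh_le; rewrite ?invr_ge0 ?(ltW c0)// ltr_pdivrMr// mul1r.
Qed.

Lemma lncoth_shift z t : 0 < t -> t < `|z| ->
  (2 + t ^+ 2) * lncoth z <= lncoth (z + t) + lncoth (z - t).
Proof.
move=> t0 tz; wlog z0 : z tz / 0 <= z.
  move=> H; have [z0|z0] := leP 0 z; first exact: H.
  have := H (- z); rewrite normrN lncothN => /(_ tz); rewrite oppr_ge0 => /(_ (ltW z0)).
  by rewrite -(lncothN (- z + t)) -(lncothN (- z - t)) !opprD !opprK (addrC (lncoth _)).
rewrite ger0_norm// in tz; apply: le_trans (lncoth_shift_gt0 t0 tz).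
apply: ler_wpM2r; first exact: lncoth_ge0.
rewrite expRN expRM_natl; have et := expR_ge1Dx t; have e0 := expR_gt0 t.
have e2 : expR t ^+ 2 + expR t ^- 2 = 2 + (expR t - (expR t)^-1) ^+ 2.
  by field; rewrite gt_eqF.
have ei : (expR t)^-1 < 1 by rewrite invf_lt1// expR_gt1.
by rewrite e2 mulrC divfK// lerD2l; apply: lerXn2r; rewrite ?nnegrE; lra.
Qed.

Lemma lncoth_powR p z : 0 < p -> 0 < `|z| -> `|z| <= 1 ->
  lncoth z <= p^-1 * (3 / `|z|) `^ p.
Proof.
move=> p0 z0 z1; rewrite -lncoth_norm; move: `|z| z0 z1 => {}z z0 z1.
have th : z / 3 <= tanh z.
  rewrite tanhE; have := expR_ge1Dx (2 * z) => e.
  have e0 : 0 < expR (2 * z) + 1 by rewrite addr_gt0 ?expR_gt0.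
  rewrite lerBrDr -lerBrDl ler_pdivrMr//.
  by apply: le_trans (_ : (1 - z / 3) * (2 + 2 * z) <= _); nra.
rewrite lncothE// ler_pdivlMl// -lnV ?posrE ?tanh_gt0// -ln_powR.
apply: (@le_trans _ _ ((tanh z)^-1 `^ p)).
  by rewrite ltW// ln_sublinear// powR_gt0// invr_gt0 tanh_gt0.
have tz := tanh_gt0 z0; have le : (tanh z)^-1 <= 3 / z.
  by rewrite -[3 / z]invf_div lef_pV2 ?posrE// (divr_gt0 z0).
by apply: ge0_ler_powR => //; rewrite ?nnegrE ltW// ?invr_gt0// divr_gt0.
Qed.

Lemma lncoth_sqrt_tanh z : 0 < z ->
  lncoth z <= 2 * (1 - tanh z ^+ 2) / Num.sqrt (tanh z).
Proof.
move=> z0; have t0 := tanh_gt0 z0; have t1 := tanh_lt1 z.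
set r := Num.sqrt (tanh z); have r0 : 0 < r by rewrite sqrtr_gt0.
have tr : tanh z = r ^+ 2 by rewrite sqr_sqrtr// ltW.
have r1 : r < 1 by rewrite -sqrtr1 ltr_sqrt.
rewrite lncothE// tr lnXn// -mulNrn -lnV ?posrE//.
have ri : 0 < r^-1 by rewrite invr_gt0.
have L : ln r^-1 <= r^-1 - 1.
  by rewrite -{1}[r^-1](subrK 1) addrC le_ln1Dx// ltrBrDr addNr.
rewrite -[ln _ *+ 2]mulr_natl.
apply: (@le_trans _ _ (2 * (r^-1 - 1))); first by lra.
rewrite -mulrA ler_pM2l// ler_pdivlMr// mulrBl mulVf ?gt_eqF//.
by nra.
Qed.

End kernel.

(** * Measures with a density *)

Section lebesgue_invariance.
Context {R : realType}.
Local Notation mu := (@lebesgue_measure R).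
Implicit Type F : R -> \bar R.

Lemma ge0_integral_shift (c : R) F : measurable_fun setT F -> (forall x, (0 <= F x)%E) ->
  (\int[mu]_x F ((x : R) + c)%R = \int[mu]_x F x)%E.
Proof.
move=> mF F0; pose h : R -> measurableTypeR R := fun x => x + c.
have mh : measurable_fun setT h by exact: measurable_funD.
transitivity (\int[pushforward mu h]_x F x)%E.
  by rewrite ge0_integral_pushforward// => y _; exact: F0.
apply: eq_measure_integral => /= A mA _.
apply/esym/(@lebesgue_measure_unique R (pushforward mu h)) => //= _ [[a b]] _ <-.
rewrite /pushforward (_ : h @^-1` _ = `]a - c, b - c]%classic); last first.
  by apply/seteqP; split=> x /=; rewrite !in_itv/= ltrBlDr lerBrDr.
rewrite !lebesgue_measure_itv/= !lte_fin ltrD2r.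
by case: ifP => // _; rewrite -!EFinB; congr EFin; lra.
Qed.

Lemma ge0_integral_opp F : measurable_fun setT F -> (forall x, (0 <= F x)%E) ->
  (\int[mu]_x F (- (x : R))%R = \int[mu]_x F x)%E.
Proof.
move=> mF F0; transitivity (\int[pushforward mu (-%R : _ -> measurableTypeR R)]_x F x)%E.
  by rewrite ge0_integral_pushforward// => y _; exact: F0.
by apply: eq_measure_integral => /= A mA _; exact: lebesgue_measureN.
Qed.

Lemma ge0_integral_reflect (c : R) F : measurable_fun setT F -> (forall x, (0 <= F x)%E) ->
  (\int[mu]_x F (c - (x : R))%R = \int[mu]_x F x)%E.
Proof.
move=> mF F0; rewrite -(ge0_integral_shift c mF F0).
have := @ge0_integral_opp (fun x => F (x + c)) => <- //.
- by apply: eq_integral => x _; rewrite addrC.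
- by apply: measurableT_comp => //; exact: measurable_funD.
Qed.

End lebesgue_invariance.

Section density.
Context {R : realType} (g : R -> R).
Hypotheses (mg : measurable_fun setT g) (g0 : forall x, 0 <= g x).
Local Notation mu := (@lebesgue_measure R).

Import HBNNSimple.

Lemma integral_density (nu : {measure set (measurableTypeR R) -> \bar R}) :
  (forall A : set (measurableTypeR R), measurable A -> nu A = \int[mu]_(x in A) (g x)%:E)%E ->
  forall F : R -> \bar R, measurable_fun setT F -> (forall x, (0 <= F x)%E) ->
  (\int[nu]_x F x = \int[mu]_x (F x * (g x)%:E))%E.
Proof.
move=> nuE F mF F0; pose h := @nnsfun_approx _ (measurableTypeR R) R setT measurableT F mF.
have cvh x : (h n x)%:E @[n --> \oo] --> F x by exact: cvg_nnsfun_approx.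
have ndh x (m n : nat) : (m <= n)%N -> h m x <= h n x.
  by move=> mn; exact/lefP/nd_nnsfun_approx.
transitivity (limn (fun n => \int[nu]_x (h n x)%:E))%E.
  rewrite -monotone_convergence//=.
  - by apply: eq_integral => x _; apply/esym/cvg_lim => //; exact: cvh.
  - by move=> n; apply/measurable_EFinP; exact: measurable_funP.
  - by move=> n x _; rewrite lee_fin.
  - by move=> x _ m n mn; rewrite lee_fin; exact: ndh.
transitivity (limn (fun n => \int[mu]_x ((h n x)%:E * (g x)%:E)))%E; last first.
  rewrite -monotone_convergence//=.
  - apply: eq_integral => x _; apply/cvg_lim => //.
    by apply: cvgeZr => //; exact: cvh.
  - by move=> n; apply: emeasurable_funM; exact/measurable_EFinP.
  - by move=> n x _; rewrite mule_ge0 ?lee_fin.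
  - by move=> x _ m n mn; rewrite lee_wpmul2r ?lee_fin ?ndh.
congr (limn _); apply/funext => n.
transitivity (\int[nu]_x (\sum_(y \in range (h n)) (y * \1_(h n @^-1` [set y]) x)%:E))%E.
  by apply: eq_integral => x _; rewrite fimfunE -fsumEFin.
have mI r : measurable_fun [set: measurableTypeR R] (fun x => (r * \1_(h n @^-1` [set r]) x)%:E).
  by apply/measurable_EFinP/measurable_funM.
rewrite ge0_integral_fsum//; last by move=> r x _; exact: nnfun_muleindic_ge0.
transitivity (\int[mu]_x (\sum_(y \in range (h n)) (y * \1_(h n @^-1` [set y]) x)%:E * (g x)%:E))%E;
  last first.
  apply: eq_integral => x _; rewrite -ge0_mule_fsuml => [|y]; last exact: nnfun_muleindic_ge0.
  by rewrite fsumEFin// -(fimfunE _ x).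
rewrite ge0_integral_fsum//; last 2 first.
  - by move=> r; apply: emeasurable_funM => //; exact/measurable_EFinP.
  - by move=> r x _; rewrite mule_ge0 ?lee_fin ?g0// -lee_fin nnfun_muleindic_ge0.
apply: eq_fsbigr => r _.
rewrite integralZl_indic_nnsfun// integral_indic// setIT nuE//.
under [RHS]eq_integral do rewrite EFinM -muleA.
have [r0|r0] := leP 0 r; last first.
  by rewrite preimage_nnfun0// integral_set0 mule0 integral0_eq// => x _; rewrite indic0 mul0e mule0.
rewrite ge0_integralZl//.
- congr (_ * _)%E; rewrite [LHS]integral_mkcond; apply: eq_integral => x _.
  by rewrite muleC epatch_indic.
- by apply: emeasurable_funM; apply/measurable_EFinP.
- by move=> x _; rewrite mule_ge0 ?lee_fin.
Qed.

Hypothesis g1 : (\int[mu]_x (g x)%:E = 1)%E.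

Definition density_measure (A : set (measurableTypeR R)) : \bar R :=
  (\int[mu]_(x in A) (g x)%:E)%E.

Let density0 : density_measure set0 = 0%E.
Proof. by rewrite /density_measure integral_set0. Qed.

Let density_ge0 A : (0 <= density_measure A)%E.
Proof. by apply: integral_ge0 => x _; rewrite lee_fin. Qed.

Let density_sigma_additive : semi_sigma_additive density_measure.
Proof.
move=> F mF tF mUF; rewrite /density_measure ge0_integral_bigcup//.
- apply: is_cvg_ereal_nneg_natsum_cond => n _ _; exact: density_ge0.
- by apply/measurable_EFinP; exact: measurable_funTS.
- by move=> x _; rewrite lee_fin.
Qed.

HB.instance Definition _ := isMeasure.Build _ _ _
  density_measure density0 density_ge0 density_sigma_additive.

Let density_setT : density_measure setT = 1%E.
Proof. exact: g1. Qed.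

HB.instance Definition _ :=
  @Measure_isProbability.Build _ _ R density_measure density_setT.

Lemma exists_density : exists nu : probability (measurableTypeR R) R,
  forall A : set (measurableTypeR R), measurable A -> nu A = (\int[mu]_(x in A) (g x)%:E)%E.
Proof. by exists density_measure. Qed.

End density.

(** * Energy and the Euler-Lagrange inequality *)

Section pairing.
Context {R : realType} (k : R -> R).
Hypotheses (mk : measurable_fun setT k) (k0 : forall x, 0 <= k x) (kN : forall x, k (- x) = k x).
Local Notation mu := (@lebesgue_measure R).
Implicit Types u v f g : R -> R.

Definition pairing u v : \bar R :=
  (\int[mu \x mu]_z (k (z.1 - z.2) * u z.1 * v z.2)%:E)%E.

Let mint u v : measurable_fun setT u -> measurable_fun setT v ->
  measurable_fun [set: measurableTypeR R * measurableTypeR R]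
    (fun z => (k (z.1 - z.2) * u z.1 * v z.2)%:E).
Proof.
move=> mu_ mv; apply/measurable_EFinP; apply: measurable_funM.
  apply: measurable_funM; last by apply: measurableT_comp => //; exact: measurable_fst.
  by apply: measurableT_comp => //; exact: measurable_funB.
by apply: measurableT_comp => //; exact: measurable_snd.
Qed.

Let int0 u v : (forall x, 0 <= u x) -> (forall x, 0 <= v x) ->
  forall z, (0 <= (k (z.1 - z.2) * u z.1 * v z.2)%:E)%E.
Proof. by move=> u0 v0 z; rewrite lee_fin !mulr_ge0. Qed.

Lemma pairing_ge0 u v : (forall x, 0 <= u x) -> (forall x, 0 <= v x) -> (0 <= pairing u v)%E.
Proof. by move=> u0 v0; apply: integral_ge0 => z _; exact: int0. Qed.

Lemma pairing_iterated u v : measurable_fun setT u -> measurable_fun setT v ->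
  (forall x, 0 <= u x) -> (forall x, 0 <= v x) ->
  pairing u v = (\int[mu]_x \int[mu]_y (k (x - y) * u x * v y)%:E)%E.
Proof.
move=> mu_ mv u0 v0; rewrite /pairing fubini_tonelli1; first by [].
- exact: mint.
- exact: int0.
Qed.

Lemma pairingC u v : measurable_fun setT u -> measurable_fun setT v ->
  (forall x, 0 <= u x) -> (forall x, 0 <= v x) -> pairing u v = pairing v u.
Proof.
move=> mu_ mv u0 v0; rewrite pairing_iterated// /pairing fubini_tonelli2.
- apply: eq_integral => y _; apply: eq_integral => x _.
  by rewrite /= -kN opprB mulrAC.
- exact: mint.
- exact: int0.
Qed.

Lemma pairingDl u1 u2 v : measurable_fun setT u1 -> measurable_fun setT u2 ->
  measurable_fun setT v -> (forall x, 0 <= u1 x) -> (forall x, 0 <= u2 x) ->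
  (forall x, 0 <= v x) ->
  pairing (u1 \+ u2) v = (pairing u1 v + pairing u2 v)%E.
Proof.
move=> m1 m2 mv u10 u20 v0; rewrite /pairing -ge0_integralD//.
- by apply: eq_integral => z _; rewrite -EFinD; congr EFin => /=; ring.
- by move=> z _; exact: int0.
- exact: mint.
- by move=> z _; exact: int0.
- exact: mint.
Qed.

Lemma pairingZl (e : R) u v : 0 <= e -> measurable_fun setT u -> measurable_fun setT v ->
  (forall x, 0 <= u x) -> (forall x, 0 <= v x) ->
  pairing (e \*o u) v = (e%:E * pairing u v)%E.
Proof.
move=> e0 mu_ mv u0 v0; rewrite /pairing -ge0_integralZl//.
- by apply: eq_integral => z _; rewrite -EFinM; congr EFin => /=; ring.
- exact: mint.
- by move=> z _; exact: int0.
Qed.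

Lemma measurable_ge0_conv u v : measurable_fun setT u -> measurable_fun setT v ->
  (forall x, 0 <= u x) -> (forall x, 0 <= v x) ->
  measurable_fun setT (fun z : R => (\int[mu]_x (u x * v (x - z))%:E)%E).
Proof.
move=> mu_ mv u0 v0; pose h (p : measurableTypeR R * measurableTypeR R) :=
  (u p.1 * v (p.1 - p.2))%:E.
have mh : measurable_fun setT h.
  apply/measurable_EFinP; apply: measurable_funM; first by apply: measurableT_comp.
  by apply: measurableT_comp => //; exact: measurable_funB.
apply: (@measurable_fun_fubini_tonelli_G _ _ _ _ _ mu h) => //.
by move=> p; rewrite lee_fin mulr_ge0.
Qed.

Lemma pairing_conv u v : measurable_fun setT u -> measurable_fun setT v ->
  (forall x, 0 <= u x) -> (forall x, 0 <= v x) ->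
  pairing u v = (\int[mu]_z ((k z)%:E * \int[mu]_x (u x * v (x - z))%:E))%E.
Proof.
move=> mu_ mv u0 v0; rewrite pairing_iterated//.
have mT : measurable_fun [set: measurableTypeR R * measurableTypeR R]
    (fun p => (k p.2 * u p.1 * v (p.1 - p.2))%:E).
  apply/measurable_EFinP; apply: measurable_funM.
    by apply: measurable_funM; apply: measurableT_comp.
  by apply: measurableT_comp => //; exact: measurable_funB.
transitivity (\int[mu]_x \int[mu]_z (k z * u x * v (x - z))%:E)%E.
  apply: eq_integral => x _.
  rewrite -(@ge0_integral_reflect _ x (fun y => (k (x - y) * u x * v y)%:E)).
  - by apply: eq_integral => y _; rewrite opprB addrC subrK.
  - apply/measurable_EFinP; apply: measurable_funM => //; apply: measurable_funM => //.
    by apply: measurableT_comp => //; exact: measurable_funB.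
  - by move=> y; rewrite lee_fin !mulr_ge0.
rewrite (fubini_tonelli (fun p : measurableTypeR R * measurableTypeR R =>
  (k p.2 * u p.1 * v (p.1 - p.2))%:E))//=; last first.
  by move=> p; rewrite lee_fin !mulr_ge0.
apply: eq_integral => z _; rewrite -ge0_integralZl//.
- by apply: eq_integral => x _; rewrite -EFinM mulrA.
- apply/measurable_EFinP; apply: measurable_funM => //.
  by apply: measurableT_comp => //; exact: measurable_funB.
- by move=> x _; rewrite lee_fin mulr_ge0.
- by rewrite lee_fin.
Qed.

Lemma pairing_le (C : R) u v : measurable_fun setT u -> measurable_fun setT v ->
  (forall x, 0 <= u x) -> (forall x, 0 <= v x <= C) ->
  (pairing u v <= (\int[mu]_z (k z)%:E) * (C%:E * \int[mu]_x (u x)%:E))%E.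
Proof.
move=> mu_ mv u0 vC; have v0 x : 0 <= v x by have /andP[] := vC x.
have C0 : 0 <= C by have /andP[h] := vC 0; exact: le_trans.
rewrite pairing_conv// -ge0_integralZr//; last 3 first.
- exact/measurable_EFinP.
- by move=> z _; rewrite lee_fin.
- by rewrite mule_ge0 ?lee_fin// integral_ge0// => x _; rewrite lee_fin.
apply: ge0_le_integral => //.
- by move=> z _; rewrite mule_ge0 ?lee_fin// integral_ge0// => x _; rewrite lee_fin mulr_ge0.
- by apply: emeasurable_funM; [exact/measurable_EFinP|exact: measurable_ge0_conv].
- by apply: emeasurable_funM => //; exact/measurable_EFinP.
move=> z _; rewrite lee_wpmul2l ?lee_fin// -ge0_integralZl//; last 2 first.
- exact/measurable_EFinP.
- by move=> x _; rewrite lee_fin.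
apply: ge0_le_integral => //.
- by move=> x _; rewrite lee_fin mulr_ge0.
- apply/measurable_EFinP; apply: measurable_funM => //.
  by apply: measurableT_comp => //; exact: measurable_funB.
- by apply: emeasurable_funM => //; exact/measurable_EFinP.
- by move=> x _; rewrite -EFinM lee_fin mulrC ler_wpM2r//; have /andP[] := vC (x - z).
Qed.

End pairing.

Section euler_lagrange.
Context {R : realType} (k Q : R -> R).
Hypotheses (mk : measurable_fun setT k) (k0 : forall x, 0 <= k x) (kN : forall x, k (- x) = k x).
Hypothesis ik : (\int[@lebesgue_measure R]_x (k x)%:E < +oo)%E.
Hypotheses (mQ : measurable_fun setT Q) (Q0 : forall x, 0 <= Q x).
Local Notation mu := (@lebesgue_measure R).
Implicit Types u v f g : R -> R.

Definition mass u : \bar R := (\int[mu]_x (u x)%:E)%E.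

Definition potential u : \bar R := (\int[mu]_x (Q x * u x)%:E)%E.

Definition admissible u : Prop :=
  [/\ measurable_fun setT u, forall x, 0 <= u x, exists C, forall x, u x <= C,
      (mass u < +oo)%E & (potential u < +oo)%E].

Lemma massD u v : measurable_fun setT u -> measurable_fun setT v ->
  (forall x, 0 <= u x) -> (forall x, 0 <= v x) -> mass (u \+ v) = (mass u + mass v)%E.
Proof.
move=> mu_ mv u0 v0; rewrite /mass -ge0_integralD//; try by move=> x _; rewrite lee_fin.
- exact/measurable_EFinP.
- exact/measurable_EFinP.
Qed.

Lemma massZ (e : R) u : 0 <= e -> measurable_fun setT u ->
  (forall x, 0 <= u x) -> mass (e \*o u) = (e%:E * mass u)%E.
Proof.
move=> e0 mu_ u0; rewrite /mass -ge0_integralZl//; try by move=> x _; rewrite lee_fin.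
exact/measurable_EFinP.
Qed.

Lemma potential_mass u : potential u = mass (Q \* u).
Proof. by []. Qed.

Lemma potentialD u v : measurable_fun setT u -> measurable_fun setT v ->
  (forall x, 0 <= u x) -> (forall x, 0 <= v x) ->
  potential (u \+ v) = (potential u + potential v)%E.
Proof.
move=> mu_ mv u0 v0; rewrite !potential_mass -massD.
- by congr mass; apply/funext => x /=; rewrite mulrDr.
- exact: measurable_funM.
- exact: measurable_funM.
- by move=> x; rewrite mulr_ge0.
- by move=> x; rewrite mulr_ge0.
Qed.

Lemma potentialZ (e : R) u : 0 <= e -> measurable_fun setT u ->
  (forall x, 0 <= u x) -> potential (e \*o u) = (e%:E * potential u)%E.
Proof.
move=> e0 mu_ u0; rewrite !potential_mass -massZ//.
- by congr mass; apply/funext => x /=; rewrite mulrCA.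
- exact: measurable_funM.
- by move=> x; rewrite mulr_ge0.
Qed.

Lemma le_mass u v : measurable_fun setT u -> measurable_fun setT v ->
  (forall x, 0 <= u x <= v x) -> (mass u <= mass v)%E.
Proof.
move=> mu_ mv uv; apply: ge0_le_integral => //.
- by move=> x _; rewrite lee_fin; have /andP[] := uv x.
- exact/measurable_EFinP.
- exact/measurable_EFinP.
- by move=> x _; rewrite lee_fin; have /andP[] := uv x.
Qed.

Lemma mass_ge0 u : (forall x, 0 <= u x) -> (0 <= mass u)%E.
Proof. by move=> u0; apply: integral_ge0 => x _; rewrite lee_fin. Qed.

Lemma admissibleD u v : admissible u -> admissible v -> admissible (u \+ v).
Proof.
move=> [mu_ u0 [C uC] ui uq] [mv v0 [D vD] vi vq]; split.
- exact: measurable_funD.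
- by move=> x /=; rewrite addr_ge0.
- by exists (C + D) => x; exact: lerD.
- by rewrite massD// lte_add_pinfty.
- by rewrite potentialD// lte_add_pinfty.
Qed.

Lemma admissibleZ e u : 0 <= e -> admissible u -> admissible (e \*o u).
Proof.
move=> e0 [mu_ u0 [C uC] ui uq]; split.
- exact: measurable_funM.
- by move=> x /=; rewrite mulr_ge0.
- by exists (e * C) => x /=; exact: ler_wpM2l.
- by rewrite massZ// lte_mul_pinfty.
- by rewrite potentialZ// lte_mul_pinfty.
Qed.

Lemma admissible_le u v : admissible v -> measurable_fun setT u ->
  (forall x, 0 <= u x <= v x) -> admissible u.
Proof.
move=> [mv v0 [C vC] vi vq] mu_ uv; split=> //.
- by move=> x; have /andP[] := uv x.
- by exists C => x; have /andP[_ h] := uv x; exact: le_trans (vC x).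
- by apply: le_lt_trans vi; exact: le_mass.
- apply: le_lt_trans vq; rewrite !potential_mass; apply: le_mass.
  + exact: measurable_funM.
  + exact: measurable_funM.
  + by move=> x /=; have /andP[? ?] := uv x; rewrite mulr_ge0//= ler_wpM2l.
Qed.

Let b u v : R := fine (pairing k u v).
Let p u : R := fine (potential u).

Lemma fin_num_pairing u v : admissible u -> admissible v -> pairing k u v \is a fin_num.
Proof.
move=> [mu_ u0 _ ui _] [mv v0 [C vC] _ _].
apply: fin_num_ge0; first exact: pairing_ge0.
have C0 : 0 <= C := le_trans (v0 0) (vC 0).
apply: (@le_lt_trans _ _ (mass k * (C%:E * mass u))%E).
  by apply: pairing_le => // x; rewrite v0 vC.
by rewrite lte_mul_pinfty ?mass_ge0 ?fin_num_ge0 ?mass_ge0 ?lte_mul_pinfty.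
Qed.

Lemma fin_num_potential u : admissible u -> potential u \is a fin_num.
Proof.
move=> [mu_ u0 _ ui uq]; apply: fin_num_ge0 => //.
by apply: mass_ge0 => x; rewrite mulr_ge0.
Qed.

Let bD u1 u2 v : admissible u1 -> admissible u2 -> admissible v ->
  b (u1 \+ u2) v = b u1 v + b u2 v.
Proof.
move=> a1 a2 a3; have [f1 f2] := (fin_num_pairing a1 a3, fin_num_pairing a2 a3).
move: a1 a2 a3 => [m1 u10 _ _ _] [m2 u20 _ _ _] [m3 v0 _ _ _].
by rewrite /b pairingDl// fineD.
Qed.

Let bZ e u v : 0 <= e -> admissible u -> admissible v -> b (e \*o u) v = e * b u v.
Proof.
move=> e0 a1 a3; have f1 := fin_num_pairing a1 a3.
move: a1 a3 => [m1 u10 _ _ _] [m3 v0 _ _ _].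
by rewrite /b pairingZl// fineM.
Qed.

Let bC u v : admissible u -> admissible v -> b u v = b v u.
Proof. by move=> [m1 u10 _ _ _] [m3 v0 _ _ _]; rewrite /b pairingC. Qed.

Let pD u v : admissible u -> admissible v -> p (u \+ v) = p u + p v.
Proof.
move=> a1 a3; have [f1 f3] := (fin_num_potential a1, fin_num_potential a3).
move: a1 a3 => [m1 u10 _ _ _] [m3 v0 _ _ _].
by rewrite /p potentialD// fineD.
Qed.

Let pZ e u : 0 <= e -> admissible u -> p (e \*o u) = e * p u.
Proof.
move=> e0 a1; have f1 := fin_num_potential a1; move: a1 => [m1 u10 _ _ _].
by rewrite /p potentialZ// fineM.
Qed.

Definition total_energy u : \bar R := ((2^-1)%:E * pairing k u u + potential u)%E.

(* Competitor: [f + e (u - v)] for small [e > 0]. To remain within nonnegative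
   densities, the bilinear expansion is applied to [g + e v = f + e u]. *)
Lemma euler_lagrange f u v d : admissible f -> admissible u -> admissible v ->
  mass u = mass v -> 0 < d -> (forall x, d * v x <= f x) ->
  (forall g, admissible g -> mass g = mass f -> (total_energy f <= total_energy g)%E) ->
  (pairing k f v + potential v <= pairing k f u + potential u)%E.
Proof.
move=> af au av uv d0 dvf fmin.
have main e : 0 < e -> e <= d -> 0 <= b f u - b f v + (p u - p v) +
    e * ((b u u + b v v - 2 * b u v) / 2).
  move=> e0 ed; have [g gP] : exists g, forall x, g x = f x + e * u x - e * v x by eexists => x.
  have aeu := admissibleZ (ltW e0) au; have aev := admissibleZ (ltW e0) av.
  have afu := admissibleD af aeu.
  have ag : admissible g.
    apply: (admissible_le afu).
    - move: af au av => [mf _ _ _ _] [mu_ _ _ _ _] [mv _ _ _ _].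
      rewrite (_ : g = fun x => f x + e * u x - e * v x); last exact/funext.
      apply: measurable_funB; last exact: measurable_funM.
      by apply: measurable_funD => //; exact: measurable_funM.
    - move=> x; have [_ u0 _ _ _] := au; have [_ v0 _ _ _] := av.
      have eu0 : 0 <= e * u x by rewrite mulr_ge0// ltW.
      have ev0 : 0 <= e * v x by rewrite mulr_ge0// ltW.
      have : e * v x <= d * v x by rewrite ler_wpM2r.
      by have := dvf x; rewrite gP /=; lra.
  have gE : g \+ (e \*o v) = f \+ (e \*o u).
    by apply/funext => x /=; rewrite gP subrK.
  have mg : mass g = mass f.
    have : mass (g \+ (e \*o v)) = mass (f \+ (e \*o u)) by rewrite gE.
    move: af au av aeu aev ag => [? ? _ ? _] [? ? _ ? _] [? ? _ ? _] [? ? _ ? _] [? ? _ _ _] [? ? _ _ _].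
    rewrite !massD// !massZ ?(ltW e0)// uv => /(congr1 (fun x => x - e%:E * mass v)%E).
    have fv : (e%:E * mass v)%E \is a fin_num.
      by rewrite fin_numM// fin_num_ge0// mass_ge0.
    by rewrite !addeK.
  have := fmin g ag mg; rewrite /total_energy.
  rewrite -(fineK (fin_num_pairing af af)) -(fineK (fin_num_potential af)).
  rewrite -(fineK (fin_num_pairing ag ag)) -(fineK (fin_num_potential ag)).
  rewrite -!EFinM -!EFinD lee_fin -!/(b _ _) -!/(p _) => le.
  have E1 : b g g + e * b v g + e * b v g + e * (e * b v v) =
      b f f + e * b u f + e * b u f + e * (e * b u u).
    have : b (g \+ (e \*o v)) (g \+ (e \*o v)) = b (f \+ (e \*o u)) (f \+ (e \*o u)) by rewrite gE.
    have agv := admissibleD ag aev.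
    rewrite !bD// (bC ag agv) (bC aev agv) (bC af afu) (bC aeu afu) !bD//.
    rewrite (bC ag aev) (bC af aeu) !bZ ?(ltW e0)// (bC av aev) (bC au aeu) !bZ ?(ltW e0)//.
    by lra.
  have E2 : b v g + e * b v v = b f v + e * b u v.
    have : b (g \+ (e \*o v)) v = b (f \+ (e \*o u)) v by rewrite gE.
    by rewrite !bD// !bZ ?(ltW e0)// (bC ag av).
  have E3 : p g + e * p v = p f + e * p u.
    have : p (g \+ (e \*o v)) = p (f \+ (e \*o u)) by rewrite gE.
    by rewrite !pD// !pZ ?(ltW e0).
  have bfu := bC af au.
  rewrite -(pmulr_rge0 _ e0); nra.
have X0 := ge0_of_affine d0 main.
rewrite -(fineK (fin_num_pairing af av)) -(fineK (fin_num_potential av)).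
rewrite -(fineK (fin_num_pairing af au)) -(fineK (fin_num_potential au)).
rewrite -!EFinD lee_fin -!/(b _ _) -!/(p _); lra.
Qed.

End euler_lagrange.

Section scaled_kernel.
Context {R : realType}.
Local Notation mu := (@lebesgue_measure R).

Lemma mass_lncoth_lty : (mass (@lncoth R) < +oo)%E.
Proof.
pose m (x : R) := 2 * (1 - tanh x ^+ 2) / Num.sqrt (tanh x).
have m0 x : 0 < x -> 0 <= m x.
  move=> x0; have t0 := tanh_gt0 x0; have t1 := tanh_lt1 x.
  rewrite divr_ge0 ?sqrtr_ge0// mulr_ge0// subr_ge0.
  by rewrite expr_le1// ltW.
pose mp := (m \_ `]0, +oo[%classic).
have mp0 x : 0 <= mp x.
  by rewrite /mp patchE; case: ifPn => //; rewrite inE/= in_itv/= andbT => /m0.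
have cm : {in `]0, +oo[, continuous m}.
  move=> x; rewrite in_itv/= andbT => x0; have t0 := tanh_gt0 x0.
  have ct : tanh y @[y --> x] --> tanh x by exact: continuous_tanh.
  apply: cvgM.
    apply: cvgM; first exact: cvg_cst.
    by apply: cvgB; [exact: cvg_cst|rewrite expr2; exact: cvgM].
  apply: cvgV; first by rewrite gt_eqF// sqrtr_gt0.
  by apply: continuous_cvg ct; exact: sqrt_continuous.
have mm : measurable_fun setT mp.
  apply/(measurable_restrictT _ _).1 => //.
  apply: open_continuous_measurable_fun; first exact: interval_open.
  by move=> x; rewrite inE; exact: cm.
apply: (@le_lt_trans _ _ (mass (mp \+ (fun x => mp (- x))))).
  apply: le_mass.
  - exact: measurable_lncoth.
  - by apply: measurable_funD => //; exact: measurableT_comp.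
  - move=> x; rewrite lncoth_ge0/=.
    have [x0|x0|<-] := ltgtP 0 x.
    + rewrite -[leLHS]addr0 lerD// /mp patchE mem_set/= ?in_itv/= ?x0//.
      exact: lncoth_sqrt_tanh.
    + rewrite -[leLHS]add0r lerD// /mp patchE mem_set/= ?in_itv/= ?oppr_gt0 ?x0//.
      by rewrite -lncothN; apply: lncoth_sqrt_tanh; rewrite oppr_gt0.
    + by rewrite /lncoth tanh0 normr0 ln0// oppr0 addr_ge0.
rewrite massD//; last exact: measurableT_comp.
have mb : (mass mp <= 4%:E)%E.
  have -> : mass mp = (\int[mu]_(x in `]0%R, +oo[) (m x)%:E)%E.
    by rewrite [RHS]integral_mkcond; apply: eq_integral => x _; rewrite /mp !patchE; case: ifP.
  apply: (@ge0_integral_oy_le R m (fun x => 4 * Num.sqrt (tanh x)) 4 _ m0 cm).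
  - move=> x x0; have t0 := tanh_gt0 x0.
    have := is_derive1_comp (is_derive1_sqrt t0) (is_derive_tanh x) => H.
    have s0 : Num.sqrt (tanh x) != 0 by rewrite gt_eqF// sqrtr_gt0.
    apply: (is_derive_eq (is_deriveZ 4 H)); rewrite /GRing.scale/= /m; field.
    exact: s0.
  - move=> x x0; have t0 := tanh_gt0 x0; have t1 := tanh_lt1 x.
    rewrite mulr_ge0 ?sqrtr_ge0//= -[leRHS]mulr1 ler_pM2l// -sqrtr1 ler_sqrt//.
    exact: ltW.
have mlt : (mass mp < +oo)%E := le_lt_trans mb (ltry _).
apply: lte_add_pinfty; first exact: mlt.
suff -> : mass (fun x => mp (- x)) = mass mp by exact: mlt.
rewrite /mass (@ge0_integral_opp _ (fun x => (mp x)%:E))//.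
  exact/measurable_EFinP.
Qed.

Definition scaled_lncoth (alpha x : R) : R := alpha * lncoth (alpha * x).

Section alpha.
Context (alpha : R).
Hypothesis alpha1 : 1 <= alpha.
Let alpha0 : 0 < alpha := lt_le_trans ltr01 alpha1.
Local Notation k := (scaled_lncoth alpha).

Lemma scaled_lncoth_ge0 x : 0 <= k x.
Proof. by rewrite mulr_ge0 ?lncoth_ge0// ltW. Qed.

Lemma scaled_lncothN x : k (- x) = k x.
Proof. by rewrite /scaled_lncoth (mulrN alpha x) lncothN. Qed.

Lemma measurable_scaled_lncoth : measurable_fun setT k.
Proof.
apply: measurable_funM => //; apply: measurableT_comp; first exact: measurable_lncoth.
exact: measurable_funM.
Qed.

Lemma mass_scaled_lncoth_lty : (mass k < +oo)%E.
Proof.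
apply: (@le_lt_trans _ _ (mass (alpha \*o lncoth))); last first.
  rewrite massZ ?lte_mul_pinfty ?mass_lncoth_lty ?lee_fin ?(ltW alpha0)//.
  - exact: measurable_lncoth.
  - by move=> x; exact: lncoth_ge0.
apply: le_mass.
- exact: measurable_scaled_lncoth.
- by apply: measurable_funM => //; exact: measurable_lncoth.
- move=> x; rewrite scaled_lncoth_ge0/= ler_pM2l//.
  have [->|x0] := eqVneq x 0; first by rewrite mulr0.
  rewrite -lncoth_norm -(lncoth_norm x); apply: lncoth_le; first by rewrite normr_gt0.
  by rewrite normrM ler_peMl// (gtr0_norm alpha0).
Qed.

Lemma mass_scaled_lncoth_ge : ((lncoth (1 : R))%:E <= mass k)%E.
Proof.
apply: (@le_trans _ _ (\int[mu]_(x in `]0%R, (alpha^-1)%R]) (alpha * lncoth 1)%:E)%E).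
  rewrite integral_cst//= lebesgue_measure_itv/= lte_fin invr_gt0 alpha0 sube0.
  by rewrite -EFinM mulrAC divff ?mul1r// gt_eqF.
apply: (@le_trans _ _ (\int[mu]_(x in `]0%R, (alpha^-1)%R]) (k x)%:E)%E).
  apply: ge0_le_integral => //.
  - by move=> x _; rewrite lee_fin mulr_ge0 ?lncoth_ge0// ltW.
  - by apply/measurable_EFinP/measurable_funTS; exact: measurable_scaled_lncoth.
  - move=> x /=; rewrite in_itv/= => /andP[x0 xa]; rewrite lee_fin ler_pM2l//.
    by apply: lncoth_le; rewrite ?mulr_gt0// mulrC -ler_pdivlMr// mul1r.
apply: ge0_subset_integral => //.
- by apply/measurable_EFinP; exact: measurable_scaled_lncoth.
- by move=> x _; rewrite lee_fin scaled_lncoth_ge0.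
Qed.

Lemma scaled_lncoth_shift z t : 0 < t -> t < `|z| ->
  (2 + t ^+ 2 * alpha ^+ 2) * k z <= k (z + t) + k (z - t).
Proof.
move=> t0 tz; rewrite /scaled_lncoth -mulrDr mulrCA ler_pM2l// mulrDr mulrBr.
rewrite -exprMn (mulrC t); apply: lncoth_shift; first by rewrite mulr_gt0.
by rewrite normrM (gtr0_norm alpha0) ltr_pM2l.
Qed.

Lemma scaled_lncoth_powR p : 0 < p -> exists2 A, 0 <= A &
  forall z, `|z| <= alpha^-1 -> k z * `|z| `^ p <= A.
Proof.
move=> p0; exists (alpha * p^-1 * 3 `^ p).
  by rewrite !mulr_ge0 ?powR_ge0 ?invr_ge0// ltW.
move=> z za; have [->|z0] := eqVneq z 0.
  rewrite normr0 powR0 ?gt_eqF// mulr0.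
  by rewrite !mulr_ge0 ?powR_ge0 ?invr_ge0// ltW.
have nz : 0 < `|z| by rewrite normr_gt0.
have naz : `|alpha * z| = alpha * `|z| by rewrite normrM gtr0_norm.
have := @lncoth_powR _ p (alpha * z) p0; rewrite naz mulr_gt0// => /(_ isT).
rewrite mulrC -ler_pdivlMr// mul1r => /(_ za) h.
rewrite /scaled_lncoth -!mulrA ler_pM2l//.
apply: (@le_trans _ _ (p^-1 * (3 / (`|z| * alpha)) `^ p * `|z| `^ p)).
  by rewrite ler_wpM2r ?powR_ge0.
have za0 : 0 < `|z| * alpha by rewrite mulr_gt0.
have q0 : 0 <= 3 / (`|z| * alpha) by rewrite divr_ge0// ltW.
have qE : 3 / (`|z| * alpha) * `|z| = 3 / alpha by field; rewrite !gt_eqF.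
rewrite -mulrA ler_pM2l ?invr_gt0// -powRM// qE.
apply: ge0_ler_powR; rewrite ?nnegrE ?(ltW p0)// ?divr_ge0// ?(ltW alpha0)//.
by rewrite ler_pdivrMr// ler_peMr.
Qed.

End alpha.
End scaled_kernel.

(** * The bound at a maximum *)

Section second_difference.
Context {R : realType} (k : R -> R).
Hypotheses (mk : measurable_fun setT k) (k0 : forall x, 0 <= k x).
Hypothesis ik : (mass k < +oo)%E.
Local Notation mu := (@lebesgue_measure R).

Lemma mass_shift (c : R) (u : R -> R) : measurable_fun setT u -> (forall x, 0 <= u x) ->
  mass (fun x : R => u (x + c)) = mass u.
Proof.
move=> mu_ u0; rewrite /mass (@ge0_integral_shift _ c (fun x => (u x)%:E))//.
exact/measurable_EFinP.
Qed.

Let mks (c : R) : measurable_fun setT (fun z : R => k (z + c)).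
Proof. by apply: measurableT_comp => //; exact: measurable_funD. Qed.

Lemma fin_num_mass_shiftM (c D : R) (d : R -> R) : measurable_fun setT d ->
  (forall z, 0 <= d z <= D) -> mass (fun z => k (z + c) * d z) \is a fin_num.
Proof.
move=> md dD; have D0 : 0 <= D by have /andP[h] := dD 0; exact: le_trans.
apply: fin_num_ge0.
  by apply: mass_ge0 => z; have /andP[? _] := dD z; rewrite mulr_ge0.
apply: (@le_lt_trans _ _ (mass (D \*o (fun z => k (z + c))))).
  apply: le_mass.
  - exact: measurable_funM.
  - exact: measurable_funM.
  - by move=> z; have /andP[? ?] := dD z; rewrite mulr_ge0//= mulrC ler_wpM2r.
have -> : mass (D \*o (fun z => k (z + c))) = (D%:E * mass k)%E.
  by rewrite massZ// mass_shift.
by apply: lte_mul_pinfty.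
Qed.

(* The singularity of [k] only contributes [o(t ^ 2)], through |z| <= t, thanks to
   the growth condition on [d]; elsewhere [kshift] applies. *)
Lemma second_difference_le (d : R -> R) (D A s beta r q t0 : R) :
  measurable_fun setT d -> (forall z, 0 <= d z <= D) ->
  0 < s -> (forall z, d z <= A * (`|z| * `|z| `^ s)) ->
  0 <= beta -> (forall z t, 0 < t -> t < `|z| ->
    (2 + t ^+ 2 * beta) * k z <= k (z + t) + k (z - t)) ->
  0 < r -> (forall p, 0 < p -> exists2 B, 0 <= B &
    forall z, `|z| <= r -> k z * `|z| `^ p <= B) ->
  0 < t0 -> (forall t, 0 < t -> t <= t0 ->
    (mass (fun z => (k (z + t) * d z)%R) + mass (fun z => (k (z - t) * d z)%R) <=
    2%:E * mass (k \* d)%R + (t ^+ 2 * q)%:E)%E) ->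
  (beta%:E * mass (k \* d)%R <= q%:E)%E.
Proof.
move=> md dD s0 dA beta0 kshift r0 kp t00 Ht.
have d0 z : 0 <= d z by have /andP[] := dD z.
have [B B0 kB] := kp (s / 2) ltac:(by rewrite divr_gt0).
have A0 : 0 <= A.
  by have := le_trans (d0 1) (dA 1); rewrite normr1 powR1 !mulr1.
have finS c := @fin_num_mass_shiftM c D d md dD.
have mkd : measurable_fun setT (k \* d) by exact: measurable_funM.
have fin0 : mass (k \* d) \is a fin_num.
  have := finS 0; rewrite (_ : (fun z => _) = k \* d)//.
  by apply/funext => z; rewrite addr0.
set X := fine (mass (k \* d)).
have E t : 0 < t -> t <= t0 -> t <= r -> t <= 1 ->
    0 <= (q - beta * X) + t `^ (s / 2) * ((2 + beta) * (2 * (A * B))).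
  move=> tp tt0 tr t1.
  pose S : set R := `[- t, t]%classic.
  have mS : measurable S by exact: measurable_itv.
  have Sz z : (z \in S) = (`|z| <= t) by rewrite /S mem_setE in_itv/= ler_norml.
  pose u1 z := \1_S z * (k z * d z).
  pose u2 z := \1_(~` S) z * (k z * d z).
  have mi (T : set R) : measurable T -> measurable_fun setT (fun z => \1_T z * (k z * d z) : R).
    by move=> mT; apply: measurable_funM => //; exact: measurable_indic.
  have u1_ge0 z : 0 <= u1 z by rewrite !mulr_ge0.
  have u2_ge0 z : 0 <= u2 z by rewrite !mulr_ge0.
  have u12 : mass (k \* d) = (mass u1 + mass u2)%E.
    rewrite -massD//; [|exact: mi|by apply: mi; exact: measurableC].
    congr mass; apply/funext => z /=; rewrite /u1 /u2 !indicE in_setC.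
    by case: (z \in S); rewrite /= ?mul1r ?mul0r ?addr0 ?add0r.
  have u1_le : (mass u1 <= (A * B * (t * t `^ (s / 2)) * (2 * t))%:E)%E.
    apply: (@le_trans _ _ (mass (fun z => \1_S z * (A * B * (t * t `^ (s / 2)))))).
      apply: le_mass; first exact: mi.
        by apply: measurable_funM => //; exact: measurable_indic.
      move=> z; rewrite u1_ge0/= /u1 indicE Sz; case: (boolP (`|z| <= t)) => [zt|_] /=; last by rewrite !mul0r.
      rewrite !mul1r.
      have ps : `|z| `^ s = `|z| `^ (s / 2) * `|z| `^ (s / 2).
        by rewrite -powRD -?splitr// (gt_eqF s0).
      apply: (@le_trans _ _ (k z * (A * (`|z| * `|z| `^ s)))); first by rewrite ler_wpM2l.
      have -> : k z * (A * (`|z| * `|z| `^ s)) = A * (k z * `|z| `^ (s / 2)) * (`|z| * `|z| `^ (s / 2)).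
        by rewrite ps; ring.
      apply: ler_pM; rewrite ?mulr_ge0 ?powR_ge0//.
        by rewrite ler_wpM2l// kB// (le_trans zt).
      apply: ler_pM; rewrite ?powR_ge0//.
      by apply: ge0_ler_powR => //; rewrite ?nnegrE ?divr_ge0 ?ltW.
    rewrite /mass; under eq_integral do rewrite mulrC EFinM.
    rewrite ge0_integralZl//=; last 2 first.
    - by apply/measurable_EFinP; exact: measurable_indic.
    - by rewrite lee_fin !mulr_ge0 ?powR_ge0// ltW.
    rewrite integral_indic// setIT /S/= lebesgue_measure_itv/= lte_fin.
    by rewrite gtrN// -EFinD -EFinM lee_fin opprK -mulr2n -[t *+ 2]mulr_natl.
  have u2_le : ((2 + t ^+ 2 * beta)%:E * mass u2 <=
      mass (fun z => (k (z + t) * d z)%R) + mass (fun z => (k (z - t) * d z)%R))%E.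
    have ge1 (c z : R) : 0 <= k (z + c) * d z by rewrite mulr_ge0.
    have mkc (c : R) : measurable_fun setT (fun z : R => k (z + c) * d z) by exact: measurable_funM.
    have b0 : 0 <= 2 + t ^+ 2 * beta by rewrite addr_ge0// mulr_ge0// sqr_ge0.
    have mu2 : measurable_fun setT u2 by apply: mi; exact: measurableC.
    rewrite -massZ// -massD//; try exact: mkc; try by move=> z; exact: ge1.
    apply: le_mass; first exact: measurable_funM.
      by apply: measurable_funD; exact: mkc.
    move=> z; rewrite mulr_ge0//= /u2 indicE in_setC Sz.
    case: (boolP (`|z| <= t)) => zt /=; first by rewrite mul0r mulr0 addr_ge0.
    rewrite -ltNge in zt; rewrite mul1r mulrA -mulrDl.
    by apply: ler_wpM2r => //; exact: kshift.
  have /andP[f1 f2] : (mass u1 \is a fin_num) && (mass u2 \is a fin_num).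
    by rewrite -fin_numD -u12.
  move: u12 u1_le u2_le (Ht t tp tt0).
  rewrite /X; rewrite -(fineK fin0) -(fineK f1) -(fineK f2).
  rewrite -(fineK (finS t)) -(fineK (finS (- t))) -!EFinM -!EFinD !lee_fin.
  move=> [->]; set y1 := fine _; set y2 := fine _; set y3 := fine _; set y4 := fine _ => h1 h2 h3.
  have y10 : 0 <= y1 by apply: fine_ge0; exact: mass_ge0.
  set T := t `^ (s / 2) in h1 *.
  have T0 : 0 <= T by exact: powR_ge0.
  have t2 : 0 < t ^+ 2 by rewrite exprn_gt0.
  have : t ^+ 2 * beta * (y1 + y2) <= t ^+ 2 * q + (2 + t ^+ 2 * beta) * y1 by lra.
  have : (2 + t ^+ 2 * beta) * y1 <= (2 + beta) * (A * B * (t * T) * (2 * t)).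
    apply: ler_pM => //; first by rewrite addr_ge0// mulr_ge0// ltW.
    by rewrite lerD2l ler_piMl// expr_le1// ltW.
  move=> l1 l2; rewrite -(pmulr_rge0 _ t2) /=; lra.
pose m := Num.min t0 (Num.min r 1).
have m0 : 0 < m by rewrite !lt_min t00 r0 ltr01.
have s20 : 0 < s / 2 by rewrite divr_gt0.
rewrite -[mass _](fineK fin0) -EFinM lee_fin -subr_ge0 -/X.
apply: (@ge0_of_affine _ _ ((2 + beta) * (2 * (A * B))) (m `^ (s / 2))).
  exact: powR_gt0.
move=> e e0 em; have ts := powRVK s20 (ltW e0).
have tm : e `^ (s / 2)^-1 <= m.
  rewrite -[leRHS](powRKV s20 (ltW m0)); apply: ge0_ler_powR => //; rewrite ?nnegrE ?powR_ge0//.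
    by rewrite invr_ge0 ltW.
  exact: ltW.
have := E (e `^ (s / 2)^-1); rewrite ts; apply.
- exact: powR_gt0.
- by rewrite (le_trans tm)// ge_min lexx.
- by rewrite (le_trans tm)// !ge_min lexx orbT.
- by rewrite (le_trans tm)// !ge_min lexx !orbT.
Qed.

End second_difference.

Section density_bound.
Context {R : realType} (k Q Q1 Q2 f : R -> R) (beta r q a b s L : R).
Hypotheses (mk : measurable_fun setT k) (k0 : forall x, 0 <= k x) (kN : forall x, k (- x) = k x).
Local Notation mu := (@lebesgue_measure R).
Hypothesis ik : (mass k < +oo)%E.
Hypotheses (beta0 : 0 < beta) (kshift : forall z t, 0 < t -> t < `|z| ->
    (2 + t ^+ 2 * beta) * k z <= k (z + t) + k (z - t)).
Hypotheses (r0 : 0 < r) (kp : forall p, 0 < p -> exists2 B, 0 <= B &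
    forall z, `|z| <= r -> k z * `|z| `^ p <= B).
Hypotheses (Q0 : forall x, 0 <= Q x) (dQ : forall x : R, is_derive x 1 Q (Q1 x))
  (dQ1 : forall x : R, is_derive x 1 Q1 (Q2 x)).
Hypotheses (f0 : forall x, 0 <= f x) (s0 : 0 < s)
  (fL : forall x y, `|f x - f y| <= L * `|x - y| `^ s)
  (f_out : forall x, ~ (a <= x <= b) -> f x = 0) (f1 : mass f = 1%E).
Hypotheses (q0 : 0 <= q) (Qq : forall x, 0 < f x -> Q2 x <= q).
Hypothesis Qunit : (potential Q \1_(`[0%R, 1%R] : set R) <= 1)%E.
Hypothesis fmin : forall g, admissible Q g -> mass g = mass f ->
  (total_energy k Q f <= total_energy k Q g)%E.

Let L0 : 0 <= L := hoelder_coef_ge0 fL.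

Let cQ : continuous Q := is_derive_continuous dQ.

Let mQ : measurable_fun setT Q := continuous_measurable_fun cQ.

Let cf : continuous f := hoelder_is_continuous s0 fL.

Let mf : measurable_fun setT f := continuous_measurable_fun cf.

Let intf : mu.-integrable setT (EFin \o f).
Proof.
apply/integrableP; split; first exact/measurable_EFinP.
under eq_integral do rewrite /= ger0_norm//.
by rewrite -/(mass f) f1 ltry.
Qed.

Let F x := Rintegral mu `]-oo, x] f.

Let dF (x : R) : is_derive x 1 F (f x).
Proof.
have x1 : x < x + 1 by lra.
have ix : mu.-integrable `]-oo, (x + 1)] (EFin \o f) by exact: integrableS intf.
have [| |d1 d2] := continuous_FTC1 x1 ix; [by rewrite ltNyr|exact: cf|].
by apply: DeriveDef; [exact: d1|rewrite -derive1E].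
Qed.

Let intF x y : x < y -> (\int[mu]_(z in `[x, y]) (f z)%:E = (F y - F x)%:E)%E.
Proof. by move=> xy; apply: integral_is_derive => //; exact: continuous_subspaceT. Qed.

Let psi e x := F (x + e) - F (x - e).

Let psi_mean e x : 0 <= e -> exists2 c, `|c - x| <= e & psi e x = f c * (2 * e).
Proof.
move=> e0; have xe : x - e <= x + e by lra.
have [c /andP[c1 c2] E] := mean_value xe (fun z _ => dF z).
exists c; first by rewrite ler_norml; apply/andP; split; lra.
by rewrite /psi E; congr (_ * _); lra.
Qed.

Let psi_ge0 e x : 0 <= e -> 0 <= psi e x.
Proof. by move=> e0; have [c _ ->] := psi_mean x e0; rewrite !mulr_ge0. Qed.

Let dpsi e (x : R) : is_derive x 1 (psi e) (f (x + e) - f (x - e)).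
Proof. exact: is_deriveB (is_derive_shift e x dF) (is_derive_shift (- e) x dF). Qed.

Let box e x : R -> R := \1_(`[x - e, x + e] : set R).

Let mbox e x : measurable_fun setT (box e x).
Proof. by apply: measurable_indic. Qed.

Let box01 e x y : 0 <= box e x y <= 1.
Proof. by rewrite /box indicE; case: (_ \in _); rewrite ?lexx ?ler01. Qed.

Let mass_box e x : 0 < e -> mass (box e x) = (2 * e)%:E.
Proof.
move=> e0; rewrite /mass /box integral_indic// setIT/= lebesgue_measure_itv/= lte_fin.
have -> : x - e < x + e by lra.
by rewrite -EFinB; congr EFin; lra.
Qed.

Let potential_box (u v : R) : (potential Q \1_(`[u, v] : set R) < +oo)%E.
Proof.
have : mu.-integrable `[u, v] (EFin \o Q).
  apply: continuous_compact_integrable; first exact: segment_compact.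
  exact: continuous_subspaceT.
move=> /integrableP[_]; rewrite integral_mkcond; apply: le_lt_trans.
apply: ge0_le_integral => //.
- by move=> x _; rewrite lee_fin mulr_ge0.
- by apply/measurable_EFinP; apply: measurable_funM => //; exact: measurable_indic.
- apply/(measurable_restrictT _ _).1 => //.
  by apply: measurableT_comp => //; apply/measurable_EFinP; exact: measurable_funTS.
- move=> x _; rewrite patchE indicE; case: ifP => _; rewrite ?mulr0//.
  by rewrite mulr1 /= ger0_norm.
Qed.

Let admissible_itv (u v : R) : u < v -> admissible Q \1_(`[u, v] : set R).
Proof.
move=> uv; split.
- exact: measurable_indic.
- by move=> x; rewrite indicE.
- by exists 1 => x; rewrite indicE; case: (_ \in _).
- rewrite /mass integral_indic// setIT/= lebesgue_measure_itv/= lte_fin uv.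
  by rewrite -EFinB ltry.
- exact: potential_box.
Qed.

Let f_bounded : exists2 C, 0 <= C & forall x, f x <= C.
Proof.
exists (L * (b - a + 1) `^ s); first by rewrite mulr_ge0// powR_ge0.
move=> x; have [/andP[ax xb]|nx] := boolP (a <= x <= b); last first.
  by rewrite f_out ?mulr_ge0 ?powR_ge0//; exact/negP.
have E : f (a - 1) = 0 by apply: f_out; lra.
have := fL x (a - 1); rewrite E subr0 ger0_norm// => /le_trans; apply.
rewrite ler_wpM2l// ge0_ler_powR ?nnegrE//; [exact: ltW|lra|].
by rewrite ger0_norm; lra.
Qed.

Let admissible_f : admissible Q f.
Proof.
have [C C0 fC] := f_bounded.
have a1b : a - 1 < b + 1.
  have [//|ba] := ltP (a - 1) (b + 1); have := f1.
  rewrite (_ : f = fun=> 0) ?/mass ?integral0; last first.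
    by apply/funext => x; apply: f_out; lra.
  by move=> /eqP; rewrite eqe eq_sym oner_eq0.
apply: (@admissible_le _ _ _ _ _ (C \*o \1_(`[a - 1, b + 1] : set R))) => //.
- by apply: admissibleZ => //; exact: admissible_itv.
- move=> x; rewrite f0 /= indicE; have [//|nx] := boolP (x \in _); first by rewrite mulr1.
  rewrite f_out ?mulr0// => axb; move: nx; rewrite notin_setE /= in_itv/=.
  by move/negP; lra.
Qed.

Let conv_box e x0 z : 0 < e ->
  (\int[mu]_x (box e x0 x * f (x - z))%:E = (psi e (x0 - z))%:E)%E.
Proof.
move=> e0; rewrite -(@ge0_integral_shift _ z (fun x => (box e x0 x * f (x - z))%:E)); last 2 first.
- apply/measurable_EFinP; apply: measurable_funM; first exact: mbox.
  by apply: measurableT_comp => //; exact: measurable_funB.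
- by move=> x; rewrite lee_fin mulr_ge0//; have /andP[] := box01 e x0 x.
have xz : x0 - z - e < x0 - z + e by lra.
rewrite /psi -(intF xz) [RHS]integral_mkcond; apply: eq_integral => x _.
rewrite patchE /box indicE addrK !mem_setE !in_itv/=.
have -> : (x0 - e <= x + z <= x0 + e) = (x0 - z - e <= x <= x0 - z + e).
  by apply/andP/andP => -[? ?]; split; lra.
by case: ifP; rewrite ?mul1r ?mul0r.
Qed.

Let mpsi e x : measurable_fun setT (fun z : R => psi e (x - z)).
Proof.
apply: measurableT_comp; first exact: continuous_measurable_fun (is_derive_continuous (dpsi e)).
exact: measurable_funB.
Qed.

Let pairing_box e x0 u : 0 < e ->
  pairing k (box e (x0 + u)) f = mass (fun z => k (z + u) * psi e (x0 - z)).
Proof.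
move=> e0; transitivity (mass (fun z => k z * psi e (x0 + u - z))).
  rewrite pairing_conv//.
  by apply: eq_integral => z _; rewrite conv_box// EFinM.
rewrite -(@mass_shift _ u (fun z => k z * psi e (x0 + u - z))).
- by congr mass; apply/funext => z; congr (_ * psi _ _); lra.
- exact: measurable_funM.
- by move=> z; rewrite mulr_ge0// psi_ge0// ltW.
Qed.

Let exists_max_psi e : 0 < e -> exists m, forall x, psi e x <= psi e m.
Proof.
move=> e0; have [ba|ab] := ltP (b + e) (a - e).
  exists 0 => x; have [c _ ->] := psi_mean x (ltW e0).
  by rewrite f_out ?mul0r ?psi_ge0 ?(ltW e0)// => /andP[? ?]; lra.
have [|m _ H] := @EVT_max R (psi e) _ _ ab.
  by apply: continuous_subspaceT; exact: is_derive_continuous (dpsi e).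
exists m => x; have [xab|nx] := boolP (a - e <= x <= b + e).
  by apply: H; rewrite in_itv.
have [c] := psi_mean x (ltW e0); rewrite ler_norml => /andP[c1 c2] ->.
rewrite f_out ?mul0r ?psi_ge0 ?(ltW e0)// => /andP[ac cb].
by move/negP: nx; apply; apply/andP; split; lra.
Qed.

Let potential_box_shift e x u :
  potential Q (box e (x + u)) = mass (fun y => Q (y + u) * box e x y).
Proof.
rewrite potential_mass -(@mass_shift _ u (Q \* box e (x + u))).
- congr mass; apply/funext => y /=; congr (_ * _).
  rewrite /box !indicE !mem_setE !in_itv/=; congr (_ %:R); congr nat_of_bool.
  by apply/andP/andP => -[? ?]; split; lra.
- by apply: measurable_funM => //; exact: mbox.
- by move=> y; rewrite mulr_ge0//; have /andP[] := box01 e (x + u) y.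
Qed.

Let c := fine (mass k).

Let massk : mass k = c%:E.
Proof. by rewrite /c fineK// fin_num_ge0// mass_ge0. Qed.

Let c_ge0 : 0 <= c.
Proof. by rewrite -lee_fin -massk mass_ge0. Qed.

Let density_bound_mollified e x0 : 0 < e -> 0 < f x0 - 2 * (L * (3 * e) `^ s) ->
  c * (f x0 - L * (3 * e) `^ s) <= c + 1 + 2 * q / beta.
Proof.
move=> e0 eta0; set eta := f x0 - _ in eta0.
have [m mmax] := exists_max_psi e0.
have s3 (y : R) : `|y| <= 3 * e -> `|y| `^ s <= (3 * e) `^ s.
  by move=> ye; apply: ge0_ler_powR => //; rewrite ?nnegrE ?(ltW s0)// (le_trans _ ye).
have [c0 c0x psi0] := psi_mean x0 (ltW e0).
have [c1 c1m psim] := psi_mean m (ltW e0).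
have fc0 : f x0 - L * (3 * e) `^ s <= f c0.
  have := fL x0 c0; rewrite distrC in c0x; have := @s3 (x0 - c0) ltac:(lra) => h1 h2.
  have := ler_norm (f x0 - f c0).
  have : L * `|x0 - c0| `^ s <= L * (3 * e) `^ s by rewrite ler_wpM2l.
  by lra.
have fc1 : f c0 <= f c1.
  by have := mmax x0; rewrite psi0 psim ler_pM2r// mulr_gt0.
have fpos y : `|y - m| <= 2 * e -> eta <= f y.
  move=> ym; have yc1 : `|c1 - y| <= 3 * e.
    by have := ler_distD m c1 y; rewrite (distrC m y); lra.
  have := fL c1 y; have := @s3 _ yc1 => h1 h2.
  have := ler_norm (f c1 - f y); have : L * `|c1 - y| `^ s <= L * (3 * e) `^ s by rewrite ler_wpM2l.
  by rewrite /eta; lra.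
have abox x : admissible Q (box e x) by apply: admissible_itv; lra.
have EL u : admissible Q u -> mass u = (2 * e)%:E ->
    (pairing k (box e m) f + potential Q (box e m) <= pairing k u f + potential Q u)%E.
  move=> au mu2; have [? ? _ _ _] := au; have [? ? _ _ _] := abox m.
  rewrite !(pairingC mk k0 kN _ mf)//.
  apply: (euler_lagrange mk k0 kN ik mQ Q0 admissible_f au (abox m) _ eta0) => //.
  - by rewrite mu2 mass_box.
  - move=> y; rewrite /box indicE mem_setE in_itv/=.
    case: (boolP (m - e <= y <= m + e)) => [/andP[? ?]|_]; last by rewrite mulr0.
    by rewrite mulr1; apply: fpos; rewrite ler_norml; apply/andP; split; lra.
pose d z := psi e m - psi e (m - z).
have md : measurable_fun setT d by apply: measurable_funB => //; exact: mpsi.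
have dD z : 0 <= d z <= psi e m.
  by rewrite /d subr_ge0 mmax/= gerBl psi_ge0// ltW.
have dpsim : f (m + e) - f (m - e) = 0.
  have m1 : m - 1 <= m + 1 by lra.
  have mm : m \in `](m - 1), (m + 1)[ by rewrite in_itv/=; apply/andP; split; lra.
  have H := @derive1_at_max _ (psi e) (m - 1) (m + 1) m m1
    (fun t _ => @ex_derive _ _ _ _ _ _ _ (dpsi e t)) mm (fun t _ => mmax t).
  by rewrite -(@derive_val _ _ _ _ _ _ _ (dpsi e m)) (@derive_val _ _ _ _ _ _ _ H).
have dA z : d z <= 2 * L * (`|z| * `|z| `^ s).
  have [w wz E] := mean_value_sub m z (dpsi e).
  rewrite /d E; apply: le_trans (ler_norm _) _; rewrite normrM.
  rewrite mulrC mulrCA ler_wpM2l// -[X in `|X|]subr0 -dpsim.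
  have h1 := fL (w + e) (m + e); have h2 := fL (w - e) (m - e).
  have wz' : `|w - m| `^ s <= `|z| `^ s.
    by apply: ge0_ler_powR => //; rewrite ?nnegrE// ltW.
  have e1 : w + e - (m + e) = w - m by lra.
  have e2 : w - e - (m - e) = w - m by lra.
  rewrite e1 in h1; rewrite e2 in h2.
  have := ler_normB (f (w + e) - f (m + e)) (f (w - e) - f (m - e)).
  have -> : f (w + e) - f (m + e) - (f (w - e) - f (m - e)) =
    f (w + e) - f (w - e) - (f (m + e) - f (m - e)) by ring.
  have : L * `|w - m| `^ s <= L * `|z| `^ s by rewrite ler_wpM2l.
  by lra.
pose D u := fine (mass (fun z => k (z + u) * d z)).
have DE u : mass (fun z => k (z + u) * d z) = (D u)%:E.
  by rewrite /D fineK//; exact: (fin_num_mass_shiftM mk k0 ik u md dD).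
have mks u : measurable_fun setT (fun z : R => k (z + u)).
  by apply: measurableT_comp => //; exact: measurable_funD.
have pbE u : pairing k (box e (m + u)) f = (c * psi e m - D u)%:E.
  rewrite pairing_box//.
  have : (mass (fun z => (k (z + u) * psi e (m - z))%R) + (D u)%:E = (c * psi e m)%:E)%E.
    rewrite -DE -massD.
    - transitivity (mass (psi e m \*o (fun z => k (z + u)))).
        by congr mass; apply/funext => z /=; rewrite /d; ring.
      by rewrite massZ ?psi_ge0 ?(ltW e0)// mass_shift// massk -EFinM mulrC.
    - exact: measurable_funM.
    - exact: measurable_funM.
    - by move=> z; rewrite mulr_ge0// psi_ge0// ltW.
    - by move=> z; rewrite mulr_ge0//; have /andP[] := dD z.
  by move=> /(congr1 (fun x => x - (D u)%:E)%E); rewrite addeK// -EFinB.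
pose V u := fine (potential Q (box e (m + u))).
have VE u : potential Q (box e (m + u)) = (V u)%:E.
  by rewrite /V fineK//; exact: fin_num_potential (abox _).
have m0 : m + 0 = m by rewrite addr0.
have EL1 u : c * psi e m - D 0 + V 0 <= c * psi e m - D u + V u.
  have := EL (box e (m + u)) (abox _) (mass_box _ e0).
  by rewrite -{1 2}m0 !pbE !VE -!EFinD lee_fin.
have V0 : 0 <= V 0.
  by rewrite fine_ge0//; apply: mass_ge0 => x; rewrite mulr_ge0//; have /andP[] := box01 e (m + 0) x.
have VV t : 0 < t -> t <= e -> V t + V (- t) <= 2 * V 0 + 4 * e * (q * t ^+ 2).
  move=> t0 te; have b0 y : 0 <= box e m y by have /andP[] := box01 e m y.
  have mQs (w : R) : measurable_fun setT (fun y : R => Q (y + w) * box e m y).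
    apply: measurable_funM; last exact: mbox.
    by apply: measurableT_comp => //; exact: measurable_funD.
  have Qs0 (w y : R) : 0 <= Q (y + w) * box e m y by rewrite mulr_ge0.
  have qt0 : 0 <= 2 * (q * t ^+ 2) by rewrite mulr_ge0// mulr_ge0// sqr_ge0.
  have -> : 2 * V 0 + 4 * e * (q * t ^+ 2) = 2 * V 0 + 2 * (q * t ^+ 2) * (2 * e) by ring.
  rewrite -lee_fin !EFinD (EFinM 2 (V 0)) (EFinM _ (2 * e)) -(mass_box m e0) -!VE m0.
  rewrite !potential_box_shift potential_mass.
  rewrite -massD// -massZ//; [|exact: measurable_funM|by move=> y; rewrite mulr_ge0].
  rewrite -massZ// -massD//.
  - apply: le_mass.
    + exact: measurable_funD.
    + apply: measurable_funD; apply: measurable_funM => //.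
      by apply: measurable_funM => //; exact: mbox.
    + move=> y; rewrite addr_ge0//= /box indicE mem_setE in_itv/=.
      case: (boolP (m - e <= y <= m + e)) => [/andP[y1 y2]|_]; last by rewrite !mulr0 addr0.
      rewrite !mulr1; apply: (second_difference_le_sup dQ dQ1 (ltW t0) q0) => w wy.
      apply: Qq; apply: lt_le_trans eta0 (fpos _ _).
      by move: wy; rewrite !ler_norml => /andP[? ?]; apply/andP; split; lra.
  - by apply: measurable_funM => //; apply: measurable_funM.
  - exact: measurable_funM.
  - by move=> y /=; rewrite !mulr_ge0.
  - by move=> y /=; rewrite mulr_ge0.
have key : (beta%:E * mass (k \* d)%R <= (4 * e * q)%:E)%E.
  apply: (second_difference_le mk k0 ik md dD s0 dA (ltW beta0) kshift r0 kp e0).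
  move=> t t0 te; rewrite !DE; have -> : k \* d = (fun z => k (z + 0) * d z).
    by apply/funext => z; rewrite addr0.
  rewrite DE -EFinM -!EFinD lee_fin.
  have := EL1 t; have := EL1 (- t); have := VV t t0 te; lra.
have D0 : beta * D 0 <= 4 * e * q.
  rewrite -lee_fin EFinM -DE (_ : (fun z => _) = k \* d)//.
  by apply/funext => z; rewrite addr0.
have unit_adm : admissible Q \1_(`[0%R, 1%R] : set R) by exact: admissible_itv.
have e20 : 0 <= 2 * e by rewrite mulr_ge0// ltW.
have unit_mass : mass (\1_(`[0%R, 1%R] : set R)) = 1%E :> \bar R.
  rewrite /mass integral_indic// setIT/= lebesgue_measure_itv/= lte_fin ltr01.
  by rewrite sube0.
have [mu1 u10 _ _ _] := unit_adm.
have lambda : c * psi e m - D 0 + V 0 <= 2 * e * (c + 1).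
  have := EL _ (admissibleZ mQ Q0 e20 unit_adm); rewrite massZ// unit_mass mule1 => /(_ erefl).
  rewrite -{1 2}m0 pbE VE -EFinD => /le_trans h; rewrite -lee_fin; apply: h.
  rewrite pairingZl// potentialZ// -muleDr//; last first.
    by apply: ge0_adde_def; rewrite inE ?pairing_ge0// mass_ge0// => x; rewrite mulr_ge0.
  rewrite [leRHS]EFinM lee_pmul2l// ?lte_fin ?mulr_gt0// EFinD leeD//.
  rewrite (pairingC mk k0 kN)//; apply: (@le_trans _ _ (mass k * (1%:E * mass f))%E).
    by apply: pairing_le => // x; rewrite indicE; case: (_ \in _); rewrite ?lexx ?ler01.
  by rewrite f1 !mule1 massk.
have cpsi : c * psi e m <= 2 * e * (c + 1 + 2 * q / beta).
  have : D 0 <= 4 * e * q / beta by rewrite ler_pdivlMr// mulrC.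
  have -> : 4 * e * q / beta = 2 * e * (2 * q / beta) by ring.
  by lra.
have : c * (f x0 - L * (3 * e) `^ s) * (2 * e) <= c * psi e m.
  rewrite psim -mulrA ler_wpM2l// ler_wpM2r//; exact: le_trans fc1.
move=> h; have := le_trans h cpsi; rewrite [leRHS]mulrC ler_pM2r// mulr_gt0//.
Qed.

Lemma density_bound x : c * f x <= c + 1 + 2 * q / beta.
Proof.
have [fx0|fx] := leP (f x) 0.
  apply: (@le_trans _ _ 0); first by rewrite mulr_ge0_le0.
  by rewrite !addr_ge0// divr_ge0 ?mulr_ge0// ltW.
rewrite -subr_ge0.
pose d0 := f x / (2 * (2 * (L + 1))).
have L1 : 0 < L + 1 by rewrite ltr_wpDl.
have d00 : 0 < d0 by rewrite divr_gt0// !mulr_gt0.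
apply: (@ge0_of_affine _ _ (c * L) d0) => // e e0 ed.
pose e' := e `^ s^-1 / 3.
have e'0 : 0 < e' by rewrite divr_gt0// powR_gt0.
have es : (3 * e') `^ s = e by rewrite mulrC divfK// powRVK// ltW.
have := @density_bound_mollified e' x e'0; rewrite es.
have : L * e <= f x / 4.
  apply: (@le_trans _ _ ((L + 1) * d0)).
    by apply: ler_pM => //; [exact: ltW|rewrite lerDl].
  by rewrite /d0 le_eqVlt; apply/orP; left; apply/eqP; field; rewrite gt_eqF.
move=> Le /(_ ltac:(lra)); lra.
Qed.

End density_bound.

(** * The rescaled problem *)

Section rescaled_problem.
Context {R : realType} (Q : R -> R) (alpha : R).
Hypotheses (alpha1 : 1 < alpha) (Q0 : forall x, 0 <= Q x) (QC : Ck 4 Q).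
Local Notation mu := (@lebesgue_measure R).
Local Notation Qs := (Qscaled Q alpha).
Let alpha0 : 0 < alpha := lt_trans ltr01 alpha1.
Let kap := alpha / primitive0 Q alpha.

Lemma is_derive_derive1n (i : nat) (x : R) : (i < 4)%N ->
  is_derive x 1 (derive1n i Q) (derive1n i.+1 Q x).
Proof.
move=> i4; have [h _] := QC; apply: DeriveDef; first exact: h.
by rewrite derive1nS derive1E.
Qed.

Let dscale (i : nat) (w x : R) : (i < 4)%N ->
  is_derive x 1 (fun y => w * derive1n i Q (alpha * y)) (w * alpha * derive1n i.+1 Q (alpha * x)).
Proof.
move=> i4; have cx : is_derive x 1 (fun y : R => alpha * y) alpha.
  by apply: is_derive_eq; rewrite /GRing.scale/= mulr1.
have := @is_derive1_comp R _ (fun y => alpha * y) x _ _ (is_derive_derive1n (alpha * x) i4) cx.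
move=> /(is_deriveZ w); congr (is_derive _ _ _ _).
by rewrite /GRing.scale/=; ring.
Qed.

Lemma is_derive_Qscaled (x : R) :
  is_derive x 1 Qs (kap * alpha * derive1n 1 Q (alpha * x)).
Proof. exact: (@dscale 0). Qed.

Lemma is_derive2_Qscaled (x : R) :
  is_derive x 1 (fun y => kap * alpha * derive1n 1 Q (alpha * y))
    (kap * alpha * alpha * derive1n 2 Q (alpha * x)).
Proof. exact: (@dscale 1). Qed.

Lemma derive1n2_Qscaled : derive1n 2 Qs = fun x => kap * alpha * alpha * derive1n 2 Q (alpha * x).
Proof.
rewrite derive1nS derive1n1 (_ : Qs^`()%classic = fun y => kap * alpha * derive1n 1 Q (alpha * y)).
  apply/funext => x; rewrite derive1E.
  exact: (@derive_val _ _ _ _ _ _ _ (is_derive2_Qscaled x)).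
apply/funext => x; rewrite derive1E.
exact: (@derive_val _ _ _ _ _ _ _ (is_derive_Qscaled x)).
Qed.

Lemma continuous_derive1n2_Qscaled : continuous (derive1n 2 Qs).
Proof.
rewrite derive1n2_Qscaled.
exact: is_derive_continuous (fun x => @dscale 2 (kap * alpha * alpha) x isT).
Qed.

Let cQ : continuous Q.
Proof. by apply: is_derive_continuous => x; exact: (@is_derive_derive1n 0). Qed.

Let P0 : 0 <= primitive0 Q alpha.
Proof. by rewrite /primitive0 (ltW alpha0); apply: Rintegral_ge0 => x _. Qed.

Lemma Qscaled_ge0 x : 0 <= Qs x.
Proof. by rewrite /Qscaled mulr_ge0// divr_ge0// ltW. Qed.

Lemma measurable_Qscaled : measurable_fun setT Qs.
Proof.
exact: continuous_measurable_fun (is_derive_continuous is_derive_Qscaled).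
Qed.

Lemma potential_Qscaled_unit : (potential Qs \1_(`[0%R, 1%R] : set R) <= 1)%E.
Proof.
have intQ : (\int[mu]_(x in `[0%R, alpha]) (Q x)%:E = (primitive0 Q alpha)%:E)%E.
  rewrite /primitive0 (ltW alpha0) /Rintegral fineK//.
  apply: integrable_fin_num => //; apply: continuous_compact_integrable.
    exact: segment_compact.
  exact: continuous_subspaceT.
have -> : potential Qs \1_(`[0%R, 1%R] : set R) =
    ((primitive0 Q alpha)^-1%:E * \int[mu]_(x in `[0%R, 1%R]) (alpha * Q (alpha * x))%:E)%E.
  rewrite [X in (_ * X)%E]integral_mkcond -ge0_integralZl//.
  - apply: eq_integral => x _; rewrite patchE indicE /Qscaled.
    by case: ifP => _; rewrite ?mulr1 ?mulr0 ?mule0// -EFinM; congr EFin; ring.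
  - apply/(measurable_restrictT _ _).1 => //; apply/measurable_EFinP; apply: measurable_funTS.
    apply: measurable_funM => //; apply: measurableT_comp; last exact: measurable_funM.
    exact: continuous_measurable_fun.
  - move=> x _; rewrite patchE; case: ifP => // _.
    by rewrite lee_fin mulr_ge0// ltW.
  - by rewrite lee_fin invr_ge0.
rewrite integral_scale_arg// intQ -EFinM lee_fin.
have [->|P1] := eqVneq (primitive0 Q alpha) 0; first by rewrite mulr0.
by rewrite mulVf.
Qed.

Lemma KscaledE (x : R) :
  Kscaled alpha x = if x == 0 then +oo%E else (scaled_lncoth alpha x)%:E.
Proof.
rewrite /Kscaled /Kpot mulf_eq0 gt_eqF//=; case: ifP => // _.
by rewrite gt0_muley// lte_fin.
Qed.

Lemma Kscaled_ge0 (x : R) : (0 <= Kscaled alpha x)%E.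
Proof. by rewrite KscaledE; case: ifP => // _; rewrite lee_fin scaled_lncoth_ge0// ltW. Qed.

Lemma measurable_Kscaled : measurable_fun setT (@Kscaled R alpha).
Proof.
rewrite (_ : Kscaled alpha = fun x => if x == 0 then +oo%E else (scaled_lncoth alpha x)%:E).
  apply: measurable_fun_ifT => //; first exact: measurable_fun_eqr.
  by apply/measurable_EFinP; exact: measurable_scaled_lncoth.
by apply/funext => x; exact: KscaledE.
Qed.

Lemma energy_density (rho : probability (measurableTypeR R) R) (f : R -> R) :
  measurable_fun setT f -> has_density rho f ->
  energy Q alpha rho = total_energy (scaled_lncoth alpha) Qs f.
Proof.
move=> mf [f0 rhoE]; rewrite /energy /total_energy.
have mk := @measurable_scaled_lncoth R alpha.
have k0 x : 0 <= scaled_lncoth alpha x := scaled_lncoth_ge0 (ltW alpha1) x.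
have intD := integral_density mf f0 rhoE.
congr (_ * _ + _)%E.
- have inner x : (\int[rho]_y Kscaled alpha (x - (y : R)) =
      \int[mu]_y (scaled_lncoth alpha (x - y) * f y)%:E)%E.
    rewrite (intD (fun y => Kscaled alpha (x - y))); last 2 first.
    + apply: (measurableT_comp measurable_Kscaled); exact: measurable_funB.
    + by move=> y; exact: Kscaled_ge0.
    apply: ge0_ae_eq_integral => //.
    + apply: emeasurable_funM; last exact/measurable_EFinP.
      apply: (measurableT_comp measurable_Kscaled); exact: measurable_funB.
    + apply/measurable_EFinP; apply: measurable_funM => //.
      by apply: measurableT_comp => //; exact: measurable_funB.
    + by move=> y _; rewrite mule_ge0 ?Kscaled_ge0 ?lee_fin.
    + by move=> y _; rewrite lee_fin mulr_ge0.
    exists [set x]; split; [exact: measurable_set1|exact: lebesgue_measure_set1|].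
    move=> y /=; apply: contra_notP => yx _; rewrite KscaledE ifF// subr_eq0.
    by apply/negP => /eqP xy; exact: yx.
  rewrite pairing_iterated//.
  under eq_integral do rewrite inner.
  have mG : measurable_fun setT (fun x : R => (\int[mu]_y (scaled_lncoth alpha (x - y) * f y)%:E)%E).
    apply: (@measurable_fun_fubini_tonelli_F _ _ _ _ _ mu
      (fun p : measurableTypeR R * measurableTypeR R => (scaled_lncoth alpha (p.1 - p.2) * f p.2)%:E)).
    + apply/measurable_EFinP; apply: measurable_funM; last by apply: measurableT_comp.
      by apply: measurableT_comp => //; exact: measurable_funB.
    + by move=> p; rewrite lee_fin mulr_ge0.
  rewrite intD//; last by move=> x; apply: integral_ge0 => y _; rewrite lee_fin mulr_ge0.
  apply: eq_integral => x _; rewrite -ge0_integralZr//.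
  + by apply: eq_integral => y _; rewrite -EFinM; congr EFin; ring.
  + apply/measurable_EFinP; apply: measurable_funM => //.
    by apply: measurableT_comp => //; exact: measurable_funB.
  + by move=> y _; rewrite lee_fin mulr_ge0.
  + by rewrite lee_fin.
- rewrite intD//.
  + by apply/measurable_EFinP; exact: measurable_Qscaled.
  + by move=> x; rewrite lee_fin Qscaled_ge0.
Qed.

End rescaled_problem.

Lemma near_lt_EFin {R : realType} (g : R -> R) (x : R) (N : \bar R) :
  {for x, continuous g} -> (N < (g x)%:E)%E -> \forall y \near x, (N < (g y)%:E)%E.
Proof.
move=> cg; case: N => [r rx| // |_].
  have H : \forall y \near x, r < g y by apply: cvgr_gt cg _ rx.
  by near=> y; rewrite lte_fin; near: y.
by near=> y; rewrite ltNyr.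
Unshelve. all: by end_near. Qed.

Section minimizer.
Context {R : realType}.
Local Notation mu := (@lebesgue_measure R).

Lemma nbhs_lebesgue_measure_gt0 (x : R) (A : set R) : nbhs x A ->
  exists2 e : R, 0 < e & ball x e `<=` A /\ (0 < mu (ball x e))%E.
Proof.
move=> /nbhs_ballP[e /= e0 eA]; exists e => //; split=> //.
by rewrite lebesgue_measure_ball ?lte_fin ?pmulrn_lgt0 ?ltW.
Qed.

Lemma le_Linfty_norm (D V : set R) (g : R -> R) (x : R) :
  open V -> V `<=` D -> continuous g -> V x -> ((g x)%:E <= Linfty_norm D g)%E.
Proof.
move=> oV VD cg Vx; rewrite /Linfty_norm unlock.
have muT : (0 < mu setT)%E.
  have [e _ [_ h]] := nbhs_lebesgue_measure_gt0 (@filterT _ _ (nbhs_filter x)).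
  by apply: lt_le_trans h _; apply: le_measure; rewrite ?inE//; exact: measurable_ball.
rewrite muT leNgt; apply/negP => lt.
have := ess_sup_ge mu (abse \o (EFin \o g \_ D)).
set N := ess_sup _ _ in lt *; move=> aeN.
have near_lt := near_lt_EFin (cg x) lt.
have [e e0 [eV mue]] := nbhs_lebesgue_measure_gt0 (filterI near_lt (open_nbhs_nbhs (conj oV Vx))).
have : mu.-negligible (ball x e).
  apply: negligibleS aeN => y /eV[Ny Vy] /= le.
  move: Ny; rewrite ltNge => /negP; apply; apply: le_trans le.
  by rewrite /= patchE mem_set ?lee_fin ?ler_norm//; exact: VD.
move/negligibleP => /(_ (measurable_ball _ _)) e1.
by rewrite e1 ltxx in mue.
Qed.

Lemma density_gt0_msupp (rho : probability (measurableTypeR R) R) (f : R -> R) (x : R) :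
  has_density rho f -> continuous f -> 0 < f x -> msupp rho x.
Proof.
move=> [f0 rhoE] cf fx U oU Ux.
have near_gt : \forall y \near x, f x / 2 < f y.
  have f2 : f x / 2 < f x by lra.
  exact: (cvgr_gt _ (cf x) _ f2).
have [e e0 [eU mue]] := nbhs_lebesgue_measure_gt0 (filterI near_gt (open_nbhs_nbhs (conj oU Ux))).
rewrite rhoE; last exact: open_measurable.
apply: (@lt_le_trans _ _ (\int[mu]_(y in ball x e) (f x / 2)%:E)%E).
  rewrite integral_cst//=; last exact: measurable_ball.
  by rewrite mule_gt0// lte_fin divr_gt0.
have mf : measurable_fun setT f by exact: continuous_measurable_fun.
apply: (@le_trans _ _ (\int[mu]_(y in ball x e) (f y)%:E)%E).
  apply: ge0_le_integral => //.
  - exact: measurable_ball.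
  - by move=> y _; rewrite lee_fin divr_ge0// ltW.
  - by apply/measurable_EFinP; exact: measurable_funTS.
  - by move=> y /eU[+ _]; rewrite lee_fin => /ltW.
apply: ge0_subset_integral => //.
- exact: measurable_ball.
- exact: open_measurable.
- by apply/measurable_EFinP; exact: measurable_funTS.
- by move=> y _; rewrite lee_fin.
- by move=> y By; have [] := eU y By.
Qed.

Lemma minimizer_total_energy (Q : R -> R) (alpha : R)
    (rho : probability (measurableTypeR R) R) (f g : R -> R) :
  1 < alpha -> (forall x, 0 <= Q x) -> Ck 4 Q -> measurable_fun setT f ->
  is_unique_minimizer Q alpha rho -> has_density rho f ->
  admissible (Qscaled Q alpha) g -> mass g = mass f ->
  (total_energy (scaled_lncoth alpha) (Qscaled Q alpha) f <=
   total_energy (scaled_lncoth alpha) (Qscaled Q alpha) g)%E.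
Proof.
move=> alpha1 Q0 QC mf [rho_min _] rhof [mg g0 _ _ _] gf.
have f1 : mass f = 1%E by have [_ rhoE] := rhof; rewrite /mass -(rhoE setT)// probability_setT.
have [nu nuE] := exists_density mg g0 (etrans gf f1).
by rewrite -(energy_density alpha1 Q0 QC mf rhof) -(energy_density alpha1 Q0 QC mg (conj g0 nuE)).
Qed.

End minimizer.

Unset Implicit Arguments.

Theorem proposition3p6 (R : realType) (Q : R -> R) (q1 q2 : R)
  (hQC4 : Ck 4 Q)
  (hQconvex : convex_function [set: R^o] Q)
  (hQ_pinfty : (ereal_inf (range (EFin \o Q)) < limf_einf (EFin \o Q) (pinfty_nbhs R))%E)
  (hQ_ninfty : (ereal_inf (range (EFin \o Q)) < limf_einf (EFin \o Q) (ninfty_nbhs R))%E)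
  (hQmin : forall x, 0 <= Q x) (hQ0 : Q 0 = 0)
  (hq : [set x | Q x = 0] = `[q1, q2]%classic)
  (hP : forall alpha, q2 < alpha ->
     - primitive0_inv Q q1 q2 (- primitive0 Q alpha) <= alpha) :
  exists C : R, 0 < C /\
    forall alpha : R, Num.max q2 1 < alpha ->
    forall (rho : probability (measurableTypeR R) R) (f : R -> R),
      is_unique_minimizer Q alpha rho ->
      has_density rho f -> hoelder_continuous f ->
      (exists a b : R, msupp rho = `[a, b]%classic) ->
      (Linfty_norm [set: R] f
       <= C%:E * (Linfty_norm (msupp rho) (derive1n 2 (Qscaled Q alpha)) + 1))%E.
Proof.
have K1 : 0 < lncoth (1 : R) by exact: lncoth_gt0.
exists (1 + 2 / lncoth 1); split; first by rewrite addr_gt0// divr_gt0.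
move=> alpha; rewrite gt_max => /andP[_ alpha1] rho f rho_min rhof [s [L [s0 _ fL]]] [a [b supp_ab]].
have C0 : 0 < 1 + 2 / lncoth (1 : R) by rewrite addr_gt0// divr_gt0.
have alpha0 : 0 < alpha by exact: lt_trans alpha1.
have cf : continuous f := hoelder_is_continuous s0 fL.
have mf : measurable_fun setT f := continuous_measurable_fun cf.
have [f0 rhoE] := rhof.
have f1 : mass f = 1%E by rewrite /mass -(rhoE setT)// probability_setT.
set N := Linfty_norm (msupp rho) _.
have N0 : (0 <= N)%E by exact: Lnorm_ge0.
have [Ny|Nfin] := eqVneq N +oo%E; first by rewrite Ny addye// gt0_muley ?lte_fin// leey.
have {Nfin} Nq : N = (fine N)%:E by rewrite fineK// ge0_fin_numE// ltey.
set q := fine N in Nq.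
have q0 : 0 <= q by rewrite -lee_fin -Nq.
have oV : open [set x | 0 < f x].
  rewrite -[[set x | _]]/(f @^-1` [set y | 0 < y]).
  by apply: open_comp => [x _|]; [exact: cf|exact: open_gt].
have Qq x : 0 < f x -> derive1n 2 (Qscaled Q alpha) x <= q.
  move=> fx; rewrite -lee_fin -Nq; apply: (le_Linfty_norm oV) => //.
  - by move=> y; exact: density_gt0_msupp.
  - exact: continuous_derive1n2_Qscaled.
have f_out x : ~ (a <= x <= b) -> f x = 0.
  move=> xab; apply/eqP; rewrite eq_le f0 andbT leNgt; apply/negP => fx.
  by apply: xab; have := density_gt0_msupp rhof cf fx; rewrite supp_ab /= in_itv.
rewrite derive1n2_Qscaled// in Qq.
set k := scaled_lncoth alpha.
have a1 := ltW alpha1.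
have b0 : 0 < alpha ^+ 2 by rewrite exprn_gt0.
have alpha_shift (z t : R) : 0 < t -> t < `|z| ->
    (2 + t ^+ 2 * alpha ^+ 2) * k z <= k (z + t) + k (z - t).
  exact: scaled_lncoth_shift.
have av0 : 0 < alpha^-1 by rewrite invr_gt0.
have bound (x : R) := @density_bound R k (Qscaled Q alpha) _ _ f (alpha ^+ 2) (alpha^-1) q a b s L
  (@measurable_scaled_lncoth R alpha) (scaled_lncoth_ge0 a1) (scaled_lncothN alpha)
  (mass_scaled_lncoth_lty a1) b0 alpha_shift av0 (scaled_lncoth_powR a1)
  (Qscaled_ge0 alpha1 hQmin) (is_derive_Qscaled alpha hQC4) (is_derive2_Qscaled alpha hQC4)
  f0 s0 fL f_out f1 q0 Qq (potential_Qscaled_unit alpha1 hQmin hQC4)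
  (fun g => @minimizer_total_energy R Q alpha rho f g alpha1 hQmin hQC4 mf rho_min rhof) x.
have massk : mass k = (fine (mass k))%:E.
  rewrite fineK// fin_num_ge0 ?mass_scaled_lncoth_lty// mass_ge0// => x.
  exact: scaled_lncoth_ge0.
have cK : lncoth (1 : R) <= fine (mass k).
  by rewrite -lee_fin -massk; exact: mass_scaled_lncoth_ge.
set c := fine _ in bound cK; have c0 : 0 < c by exact: lt_le_trans cK.
have le_f (x : R) : f x <= (1 + 2 / lncoth 1) * (q + 1).
  rewrite -(ler_pM2l c0); apply: le_trans (bound x) _.
  have : 2 * q / alpha ^+ 2 <= 2 * q.
    by rewrite ler_pdivrMr// ler_peMr ?mulr_ge0// exprn_ege1.
  have : 2 * (q + 1) <= c * (2 / lncoth 1) * (q + 1).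
    rewrite ler_wpM2r//; first by rewrite addr_ge0.
    by rewrite mulrCA -[leLHS]mulr1 ler_pM2l// ler_pdivlMr// mul1r.
  by nra.
rewrite Nq -EFinD -EFinM /Linfty_norm unlock; case: ifP => _.
  apply/ess_supP; apply: nearW => x /=.
  by rewrite patchE mem_setT/= lee_fin ger0_norm.
by rewrite lee_fin; apply: mulr_ge0; [exact: ltW|exact: addr_ge0].
Qed.
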